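(* If $\mathrm{WGr}(d,n)$ is a divisive weighted Grassmann orbifold, then it has a $(\mathbb{C}^* )^n$-invariant cell structure with only even dimensional cells.
   Context: Fix integers $1\le d<n$, a vector $W=(w_1,\dots,w_n)\in(\mathbb{Z}_{\ge 0})^n$ and an integer $a\ge 1$. Let $M_d(n,d)$ be the set of complex $n\times d$ matrices of rank $d$. For $A,B\in M_d(n,d)$ write $A\sim_w B$ if $B=\mathrm{diag}(t^{w_1},\dots,t^{w_n})\,A\,T$ for some $T\in \mathrm{GL}(d,\mathbb{C})$ and $t\in\mathbb{C}^*$ with $t^a=\det(T)$. The weighted Grassmann orbifold associated to $(W,a)$ is $\mathrm{WGr}(d,n):=M_d(n,d)/\!\sim_w$ with the quotient topology; $(\mathbb{C}^* )^n$ acts on it by $(t_1,\dots,t_n)\cdot[A]=[\mathrm{diag}(t_1,\dots,t_n)A]$. A Schubert symbol for $d<n$ is a sequence of integers $\lambda=(\lambda_1,\dots,\lambda_d)$ with $1\le\lambda_1<\cdots<\lambda_d\le n$. Partial order: $\lambda\preceq\mu$ if $\lambda_j\le\mu_j$ for all $j$. Put $m:=\binom{n}{d}-1$ and fix a total order $\lambda^0<\lambda^1<\cdots<\lambda^m$ on the set of Schubert symbols which preserves $\preceq$ (i.e. $\lambda\preceq\mu$ implies $\lambda\le\mu$); write $\lambda^i=(\lambda^i_1,\dots,\lambda^i_d)$. For $\sigma\in S_n$ put $\sigma c_i:=a+\sum_{j=1}^d w_{\sigma(\lambda^i_j)}$ for $0\le i\le m$. $\mathrm{WGr}(d,n)$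 is called divisive if there exists $\sigma\in S_n$ such that $\sigma c_i$ divides $\sigma c_{i-1}$ for $i=1,\dots,m$. A cell structure is $(\mathbb{C}^* )^n$-invariant if each (open) cell is a $(\mathbb{C}^* )^n$-invariant subset. *)

(* Defs.v *)
From HB Require Import structures.
From mathcomp Require Import all_boot all_order all_algebra perm.
From mathcomp Require Import complex.
From mathcomp Require Import all_classical all_reals all_analysis.
Import Order.TTheory GRing.Theory Num.Theory.
Import numFieldNormedType.Exports.

Set Implicit Arguments.
Unset Strict Implicit.
Unset Printing Implicit Defensive.

Local Open Scope classical_set_scope.
Local Open Scope ring_scope.
Local Open Scope quotient_scope.

(* C = R[i] with the topology of the complex modulus. *)
HB.instance Definition _ (R : realType) := NormedModule.copy R[i] R[i]^o.

Section Cells.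
Context {R : realType}.
Implicit Types k : nat.

(* Euclidean discs: the norm that 'rV[R]_k carries is the sup norm. *)
Definition sqnorm k (x : 'rV[R]_k) : R := \sum_(i < k) x 0 i ^+ 2.
Definition closed_disc k : set 'rV[R]_k := [set x | sqnorm x <= 1].
Definition open_disc k : set 'rV[R]_k := [set x | sqnorm x < 1].
Definition unit_sphere k : set 'rV[R]_k := [set x | sqnorm x = 1].

Definition embedding_on (X Y : topologicalType) (A : set X) (f : X -> Y) :=
  {within A, continuous f} /\
  exists g : Y -> X,
    (forall x, A x -> g (f x) = x) /\ {within f @` A, continuous g}.

End Cells.

Unset Implicit Arguments.

(* A CW structure on X, given by its characteristic maps D^k -> X (only their
   values on the closed disc matter). *)
Record cw_structure (R : realType) (X : topologicalType) := CWStructure {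
  cw_index : Type;
  cw_dim : cw_index -> nat;
  cw_char : forall i, 'rV[R]_(cw_dim i) -> X;
  cw_hausdorff : hausdorff_space X;
  cw_continuous : forall i, {within @closed_disc R (cw_dim i), continuous (cw_char i)};
  cw_embedding : forall i, embedding_on (@open_disc R _) (cw_char i);
  cw_disjoint :
    trivIset [set: cw_index] (fun i => cw_char i @` @open_disc R _);
  cw_cover :
    \bigcup_(i in [set: cw_index]) (cw_char i @` @open_disc R _) = [set: X];
  cw_boundary : forall i, exists F : set cw_index,
    [/\ finite_set F,
        forall j, F j -> (cw_dim j < cw_dim i)%N
      & cw_char i @` @unit_sphere R _ `<=`
          \bigcup_(j in F) (cw_char j @` @open_disc R _)];
  cw_weak : forall A : set X,
    (forall i, closed (A `&` cw_char i @` @closed_disc R _)) -> closed A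
}.

Set Implicit Arguments.
Arguments cw_index {R X}.
Arguments cw_dim {R X}.
Arguments cw_char {R X}.

Definition open_cell (R : realType) (X : topologicalType)
    (K : cw_structure R X) (i : cw_index K) : set X :=
  cw_char K i @` @open_disc R (cw_dim K i).

Section WeightedGrassmann.
Variables (R : realType) (n d : nat) (w : 'I_n -> nat) (a : nat).
Local Notation C := R[i].

(* M_d(n, d), with the subspace topology. *)
Definition full_rank : Type :=
  set_type [set A : 'M[C]_(n, d) | \rank A = d].
HB.instance Definition _ := Topological.on full_rank.

Definition wsim (A B : full_rank) : Prop :=
  exists (T : 'M[C]_d) (t : C),
    [/\ T \in unitmx, t != 0, t ^+ a = \det T
      & sval B = diag_mx (\row_i t ^+ w i) *m sval A *m T].

Lemma wsim_refl A : wsim A A.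
Proof.
exists 1%:M, 1; split; rewrite ?unitmx1 ?oner_eq0 ?expr1n ?det1//.
rewrite mulmx1 (_ : \row_i _ = const_mx 1); last first.
  by apply/rowP => i; rewrite !mxE expr1n.
by rewrite diag_const_mx mul1mx.
Qed.

Lemma wsim_sym A B : wsim A B -> wsim B A.
Proof.
move=> [T [t [uT t0 tT eB]]]; exists (invmx T), t^-1; split.
- by rewrite unitmx_inv.
- by rewrite invr_eq0.
- by rewrite det_inv -tT exprVn.
rewrite eB !mulmxA mulmxK// mulmx_diag.
rewrite (_ : \row_i _ = const_mx 1) ?diag_const_mx ?mul1mx//.
by apply/rowP => i; rewrite !mxE exprVn mulVf// expf_neq0.
Qed.

Lemma wsim_trans A B D : wsim A B -> wsim B D -> wsim A D.
Proof.
move=> [T [t [uT t0 tT eB]]] [S [s [uS s0 sS eD]]].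
exists (T *m S), (s * t); split.
- by rewrite unitmx_mul uT.
- by rewrite mulf_neq0.
- by rewrite exprMn tT sS det_mulmx mulrC.
rewrite eD eB !mulmxA mulmx_diag; congr (diag_mx _ *m _ *m _ *m _).
by apply/rowP => i; rewrite !mxE exprMn.
Qed.

Definition wsimb (A B : full_rank) : bool := `[< wsim A B >].

Lemma wsimb_equiv : equiv_class_of wsimb.
Proof.
split=> [A|A B|B A D].
- exact/asboolP/wsim_refl.
- by apply/asboolP/asboolP; apply: wsim_sym.
- by move=> /asboolP AB /asboolP BD; apply/asboolP/(wsim_trans AB).
Qed.

Definition wsim_rel : equiv_rel full_rank := EquivRelPack wsimb_equiv.

(* The weighted Grassmann orbifold, with the quotient topology. *)
Definition WGr : Type := quotient_topology {eq_quot wsim_rel}.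
HB.instance Definition _ := Topological.on WGr.
HB.instance Definition _ := Quotient.on WGr.

Definition torus : Type :=
  set_type [set t : 'rV[C]_n | forall i, t 0 i != 0].

Lemma torus_mul_subproof (t : torus) (A : full_rank) :
  diag_mx (sval t) *m sval A \in [set A : 'M[C]_(n, d) | \rank A = d].
Proof.
apply/mem_set => /=; rewrite eqmxMfull; first exact: (set_valP A).
rewrite row_full_unit unitmxE det_diag unitfE; apply/prodf_neq0 => i _.
exact: (set_valP t).
Qed.

Definition torus_mul (t : torus) (A : full_rank) : full_rank :=
  exist _ (diag_mx (sval t) *m sval A) (torus_mul_subproof t A).

Definition torus_act (t : torus) (x : WGr) : WGr :=
  \pi_WGr (torus_mul t (repr x)).

Lemma torus_act_pi (t : torus) (A : full_rank) :
  torus_act t (\pi_WGr A) = \pi_WGr (torus_mul t A).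
Proof.
have /eqmodP/asboolP [T [s [uT s0 sT e]]] :
  \pi_({eq_quot wsim_rel}) A = \pi_({eq_quot wsim_rel}) (repr (\pi_WGr A)).
  exact/esym/(reprK (\pi_WGr A)).
suff : \pi_({eq_quot wsim_rel}) (torus_mul t A) =
       \pi_({eq_quot wsim_rel}) (torus_mul t (repr (\pi_WGr A))) by exact/esym.
apply/eqmodP/asboolP; exists T, s; split => //=.
rewrite e !mulmxA !mulmx_diag; congr (diag_mx _ *m _ *m _).
by apply/rowP => i; rewrite !mxE mulrC.
Qed.

End WeightedGrassmann.

(* Schubert symbols, with values in {0, ..., n-1} instead of {1, ..., n}. *)
Definition schubert (n d : nat) : Type :=
  {l : {ffun 'I_d -> 'I_n} |
    [forall i : 'I_d, forall j : 'I_d, (i < j)%N ==> (l i < l j)%N]}.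

Definition schubert_le n d (l m : schubert n d) : Prop :=
  forall j, (sval l j <= sval m j)%N.

(* lam lists all symbols as lam 0 < lam 1 < ... in a total order which
   preserves schubert_le. *)
Definition schubert_order n d (lam : 'I_('C(n, d)) -> schubert n d) : Prop :=
  bijective lam /\
  forall i j, schubert_le (lam i) (lam j) -> (i <= j)%N.

Definition sigma_c n d (w : 'I_n -> nat) (a : nat)
    (lam : 'I_('C(n, d)) -> schubert n d) (s : 'S_n) (i : 'I_('C(n, d))) : nat :=
  (a + \sum_(j < d) w (s (sval (lam i) j)))%N.

Definition divisive n d (w : 'I_n -> nat) (a : nat)
    (lam : 'I_('C(n, d)) -> schubert n d) : Prop :=
  exists s : 'S_n, forall i j : 'I_('C(n, d)),
    nat_of_ord j = i.+1 -> (sigma_c w a lam s j %| sigma_c w a lam s i)%N.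

(* Main.v *)
(** Two full rank matrices are identified in the orbifold exactly when their
    Pluecker coordinates differ by [p_f |-> t ^ c_f * p_f] for one [t <> 0],
    with all [c_f > 0], so the orbifold sits in a weighted projective space.
    The cell of a symbol [lambda] consists of the points with [p_lambda <> 0]
    and [p_mu = 0] unless [mu] is below [lambda].

    A characteristic map is a product of rotations of two consecutive rows,
    one for each step that lowers an entry of [lambda] by one.  A rotation is
    parametrised by [z] in the unit disc, with entries [z] and
    [sqrt (1 - |z|^2)], so the source is a polydisc.  On it
    [\sum_f |p_f|^2] is constant and [p_lambda] is the product of the
    [sqrt (1 - |z_i|^2)]: it is positive inside and vanishes on the boundary,
    which is therefore sent to cells of smaller dimension.  Inside, the point
    of the polydisc is determined by the Pluecker vector.  If the Pluecker
    vectors of two interior points are related by [t], then [|t| = 1] by the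
    norm condition, [t ^ c_lambda = 1] by positivity of [p_lambda], and
    divisibility of [c_f] by [c_lambda] makes [t] act trivially on all
    coordinates; hence the map is injective on the open cell.  Every point of
    the cell can be scaled to have the prescribed norm and [p_lambda > 0],
    which gives surjectivity. *)

Require Import Defs.
From HB Require Import structures.
From mathcomp Require Import all_boot all_order all_algebra perm.
From mathcomp Require Import complex.
From mathcomp Require Import all_classical all_reals all_analysis.
Import Order.TTheory GRing.Theory Num.Theory.
Import numFieldNormedType.Exports.

Set Implicit Arguments.
Unset Strict Implicit.
Unset Printing Implicit Defensive.

Local Open Scope ring_scope.

(** * Pluecker coordinates *)

Definition plucker (F : comNzRingType) n d (A : 'M[F]_(n, d))
  (f : 'I_d -> 'I_n) : F :=
  \det (rowsub f A).

Definition update n d (f : 'I_d -> 'I_n) (k : 'I_d)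
  (r : 'I_n) : {ffun 'I_d -> 'I_n} :=
  [ffun j => if j == k then r else f j].

Section PluckerRing.
Variables (F : comNzRingType) (n d : nat).
Implicit Types (A B : 'M[F]_(n, d)) (f g : 'I_d -> 'I_n).

Lemma eq_plucker A f g : f =1 g -> plucker A f = plucker A g.
Proof. by move=> fg; congr (\det _); apply/matrixP => i j; rewrite !mxE fg. Qed.

(** Cauchy-Binet in unreduced form: the Leibniz formula is expanded by distributivity and the sum
    runs over all tuples [g], so nothing has to be sorted. *)
Lemma plucker_mul (S : 'M[F]_n) A f :
  plucker (S *m A) f =
    \sum_(g : {ffun 'I_d -> 'I_n}) (\prod_i S (f i) (g i)) * plucker A g.
Proof.
rewrite /plucker /determinant.
transitivity (\sum_(s : 'S_d) \sum_(g : {ffun 'I_d -> 'I_n})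
   (-1) ^+ s * ((\prod_i S (f i) (g i)) * \prod_i A (g i) (s i))).
  apply: eq_bigr => s _; rewrite -mulr_sumr; congr (_ * _).
  under [RHS]eq_bigr do rewrite -big_split /=.
  rewrite -(bigA_distr_bigA (fun i j => S (f i) j * A j (s i))) /=.
  by apply: eq_bigr => i _; rewrite !mxE.
rewrite exchange_big; apply: eq_bigr => g _ /=; rewrite mulr_sumr.
apply: eq_bigr => s _; rewrite mulrCA; congr (_ * (_ * _)).
by apply: eq_bigr => i _; rewrite !mxE.
Qed.

Lemma plucker_mulr A (T : 'M[F]_d) f : plucker (A *m T) f =
  plucker A f * \det T.
Proof. by rewrite /plucker -det_mulmx; congr (\det _);
  rewrite mul_rowsub_mx. Qed.

Lemma plucker_diag (v : 'rV[F]_n) A f :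
  plucker (diag_mx v *m A) f = (\prod_i v 0 (f i)) * plucker A f.
Proof.
rewrite /plucker.
have -> : \prod_i v 0 (f i) = \det (diag_mx (\row_i v 0 (f i))).
  by rewrite det_diag; apply: eq_bigr => i _; rewrite mxE.
rewrite -det_mulmx; congr (\det _); apply/matrixP => i j.
by rewrite !mul_diag_mx !mxE.
Qed.

Lemma plucker_inj A f : plucker A f != 0 -> injective f.
Proof.
move=> nz i j fij; apply: contraNeq nz => ij; apply/eqP.
by apply: (determinant_alternate ij) => k; rewrite !mxE fij.
Qed.

Lemma plucker_perm A f (p : 'S_d) : plucker A (f \o p) = (-1)
  ^+ p * plucker A f.
Proof.
rewrite /plucker -det_perm -det_mulmx -row_permE; congr (\det _).
by apply/matrixP => i j; rewrite !mxE.
Qed.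

Lemma plucker_linear A B f k x y r1 r2 :
  row (f k) B = x *: row r1 A + y *: row r2 A ->
  (forall j, j != k -> row (f j) B = row (f j) A) ->
  plucker B f = x * plucker A (update f k r1) + y * plucker A (update f k r2).
Proof.
have rowE (M : 'M[F]_(n, d)) h i : row i (rowsub h M) = row (h i) M.
  by apply/rowP => j; rewrite !mxE.
have updE r : row' k (rowsub (update f k r) A) = row' k (rowsub f A).
  by apply/matrixP => i j; rewrite !mxE ffunE eq_sym (negPf (neq_lift _ _)).
move=> Bk Bj.
have row'E : row' k (rowsub f A) = row' k (rowsub f B).
  apply/matrixP => i j; have ne : lift k i != k by rewrite eq_sym neq_lift.
  have /rowP/(_ j) := Bj _ ne.
  by rewrite !mxE => ->.
apply: (@determinant_multilinear _ _ _ _ _ k).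
- by rewrite !rowE !ffunE eqxx.
- by rewrite updE row'E.
- by rewrite updE row'E.
Qed.

(** For distinct indices this is the identity with the block of rows [x y] and [z t] placed at [r1]
    and [r2]. *)
Definition mix_rows (r1 r2 : 'I_n) (x y z t : F) : 'M[F]_n :=
  \matrix_(i, j) if i == r1 then x *+ (j == r1) + y *+ (j == r2)
                 else if i == r2 then z *+ (j == r1) + t *+ (j == r2)
                 else (i == j)%:R.

Lemma row_mix_rows_mul r1 r2 x y z t A i :
  row i (mix_rows r1 r2 x y z t *m A) =
    if i == r1 then x *: row r1 A + y *: row r2 A
    else if i == r2 then z *: row r1 A + t *: row r2 A else row i A.
Proof.
have comb a b : (\row_j (a *+ (j == r1) + b *+ (j == r2))) *m A =
    a *: row r1 A + b *: row r2 A.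
  rewrite (_ : \row_j _ = a *: delta_mx 0 r1 + b *: delta_mx 0 r2).
    by rewrite mulmxDl -!scalemxAl -!rowE.
  by apply/rowP => j; rewrite !mxE eqxx /= !mulr_natr.
rewrite row_mul; case: ifP => [|ir1]; last case: ifP => [|ir2].
- by move=> /eqP ->; rewrite -comb; congr (_ *m _); apply/rowP => j;
  rewrite !mxE eqxx.
- move=> /eqP i2; rewrite -comb; congr (_ *m _); apply/rowP => j.
  by rewrite !mxE ir1 i2 eqxx.
- rewrite [in RHS]rowE; congr (_ *m _); apply/rowP => j.
  by rewrite !mxE ir1 ir2 eqxx eq_sym.
Qed.

Lemma mix_rows_entry r1 r2 x y z t i j : mix_rows r1 r2 x y z t i j != 0 ->
  i = j \/ (i \in [:: r1; r2]) /\ (j \in [:: r1; r2]).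
Proof.
rewrite mxE !inE; case: (eqVneq i r1) => [->|i1].
  case: (eqVneq j r1) => [->|_]; first by left.
  by case: (eqVneq j r2) => [_|_]; [right; rewrite orbT | rewrite addr0 eqxx].
case: (eqVneq i r2) => [->|i2].
  case: (eqVneq j r1) => [_|_]; first by right.
  by case: (eqVneq j r2) => [->|_]; [left | rewrite addr0 eqxx].
by case: (eqVneq i j) => [|_]; [left | rewrite eqxx].
Qed.

End PluckerRing.

Section PluckerField.
Variables (F : fieldType) (n d : nat).
Implicit Types (A B : 'M[F]_(n, d)) (f g : 'I_d -> 'I_n).

Lemma plucker_rank A f : plucker A f != 0 -> \rank A = d.
Proof.
move=> nz; apply/eqP; rewrite eqn_leq rank_leq_col /=.
have {1}<- : \rank (rowsub f A) = d.
  by apply: mxrank_unit; rewrite unitmxE unitfE.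
apply: mxrankS; apply/row_subP => i; rewrite (_ : row i _ = row (f i) A).
  exact: row_sub.
by apply/rowP => j; rewrite !mxE.
Qed.

Lemma rank_plucker A : \rank A = d -> exists f : {ffun 'I_d -> 'I_n},
  plucker A f != 0.
Proof.
move=> rA; have fA : row_full A by rewrite /row_full rA.
by exists (fullrankfun fA); rewrite /plucker -unitfE -unitmxE fullrowsub_unit.
Qed.

(** Cramer's rule for the matrix normalised to be the identity on the rows [f]. *)
Lemma plucker_normalized A f : plucker A f != 0 ->
  forall r k, (A *m invmx (rowsub f A)) r k = plucker A (update f k r)
    / plucker A f.
Proof.
move=> nz r k; set B := A *m _.
have uf : rowsub f A \in unitmx by rewrite unitmxE unitfE.
have fB : rowsub f B = 1%:M by rewrite -mul_rowsub_mx mulmxV.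
have -> : plucker A (update f k r) / plucker A f = plucker B (update f k r).
  by rewrite plucker_mulr det_inv.
(* In column [k] the rows other than [k] are those of the identity, so the expansion has one
   term. *)
clearbody B; rewrite /plucker (expand_det_col _ k) (bigD1 k) //= big1 ?addr0;
  last first.
  move=> j jk; have /matrixP/(_ j k) := fB.
  by rewrite !mxE ffunE (negPf jk) => ->; rewrite mul0r.
rewrite mxE ffunE eqxx /cofactor -signr_odd oddD addbb expr0 mul1r.
rewrite (_ : row' _ _ = 1%:M) ?det1 ?mulr1 //.
apply/matrixP => i j; have ne : lift k i == k = false.
  by rewrite eq_sym (negPf (neq_lift _ _)).
have /matrixP/(_ (lift k i) (lift k j)) := fB.
by rewrite !mxE ffunE ne (inj_eq lift_inj).
Qed.

(** After normalising the rows [f] both matrices have the same entries, since these are ratios of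
    coordinates; [c] reappears as the determinant of the base change. *)
Lemma plucker_eq_scale A B c : \rank A = d -> c != 0 ->
  (forall f : {ffun 'I_d -> 'I_n}, plucker B f = c * plucker A f) ->
  exists T, [/\ T \in unitmx, \det T = c & B = A *m T].
Proof.
move=> /rank_plucker [f nzA] c0 eBA.
have nzB : plucker B f != 0 by rewrite eBA mulf_neq0.
have uA : rowsub f A \in unitmx by rewrite unitmxE unitfE.
have uB : rowsub f B \in unitmx by rewrite unitmxE unitfE.
exists (invmx (rowsub f A) *m rowsub f B); split.
- by rewrite unitmx_mul unitmx_inv uA uB.
- by rewrite det_mulmx det_inv -!/(plucker _ f) eBA mulrC mulfK.
- rewrite mulmxA (_ : A *m _ = B *m invmx (rowsub f B)) ?mulmxKV //.
  apply/matrixP => r k; rewrite !plucker_normalized // !eBA.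
  by rewrite -mulf_div divff // mul1r.
Qed.

End PluckerField.

(** * The counting order on index tuples *)

Section Below.
Variables (n d : nat).
Implicit Types f g h : 'I_d -> 'I_n.

(* On increasing tuples [below] is the componentwise order of Schubert symbols;
   counting entries makes it insensitive to the order of the entries. *)
Definition count_ge (x : nat) f : nat := \sum_j (x <= f j)%N.
Definition below f g : Prop := forall x, (count_ge x f <= count_ge x g)%N.

Lemma below_trans g f h : below f g -> below g h -> below f h.
Proof. by move=> fg gh x; exact: leq_trans (fg x) (gh x). Qed.

Lemma count_ge_perm x f (p : 'S_d) : count_ge x (f \o p) = count_ge x f.
Proof. by rewrite /count_ge [RHS](reindex_inj (@perm_inj _ p)). Qed.

Lemma below_perm f g (p : 'S_d) : (forall j, f j <= g (p j))%N -> below f g.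
Proof.
move=> fg x; rewrite -(count_ge_perm x g p); apply: leq_sum => j _ /=.
by case: (leqP x (f j)) => // xf; rewrite (leq_trans xf (fg j)).
Qed.

Lemma count_geS x f : injective f ->
  count_ge x f = (count_ge x.+1 f + (x \in [seq val (f j) | j : 'I_d]))%N.
Proof.
move=> fI; case: mapP => [[k _ ->]|nx].
  rewrite /count_ge (bigD1 k) //= [in RHS](bigD1 k) //= leqnn ltnn add0n addnC.
  congr (_ + _)%N; apply: eq_bigr => j jk.
  rewrite leq_eqVlt; case: eqP => // /val_inj/fI kj.
  by rewrite kj eqxx in jk.
rewrite addn0; apply: eq_bigr => j _; rewrite leq_eqVlt; case: eqP => // e.
by case: nx; exists j; rewrite ?mem_enum.
Qed.

(** For an injective tuple the drop of the count after level [x] tells whether [x] is a value, so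
    equal counts mean equal images. *)
Lemma count_ge_image f g : injective f -> injective g ->
  (forall x, count_ge x f = count_ge x g) ->
  exists p : 'S_d, g =1 f \o p.
Proof.
move=> fI gI efg.
have im j : exists k, f k == g j.
  have := count_geS (g j) gI; rewrite -!efg count_geS // => /addnI.
  rewrite [X in _ = nat_of_bool X](_ : _ = true); last first.
    by apply/mapP; exists j; rewrite ?mem_enum.
  by case: mapP => // -[k _ e] _; exists k; apply/eqP/val_inj.
pose q j := xchoose (im j); have qP j : f (q j) = g j
  by apply/eqP/(xchooseP (im j)).
have qI : injective q by move=> i j e; apply: gI; rewrite -!qP e.
by exists (perm qI) => j /=; rewrite permE qP.
Qed.

(** Layer-cake formula: an entry is the number of levels below it. It lets sums be compared through
    counts. *)
Lemma count_ge_sum f : (\sum_j f j = \sum_(x < n) count_ge x.+1 f)%N.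
Proof.
rewrite exchange_big /=; apply: eq_bigr => j _.
have lefn : (f j <= n)%N by apply: ltnW.
rewrite -[LHS]card_ord -sum1_card (big_ord_widen _ (fun=> 1%N) lefn)
  big_mkcond /=.
by apply: eq_bigr => x _; case: (x < f j)%N.
Qed.

End Below.

Section Echelon.
Variables (F : fieldType) (n d : nat).
Implicit Types (A B : 'M[F]_(n, d)) (f g : 'I_d -> 'I_n).

(** A nonzero term of the Leibniz expansion supplies a permutation [p] with [g j <= f (p j)] for all
    [j]. *)
Lemma plucker_below B f g : (forall r k, B r k != 0 -> (r <= f k)%N) ->
  plucker B g != 0 -> below g f.
Proof.
move=> B0; have [/existsP [p /forallP gp] _|/existsPn np] :=
  boolP [exists p : 'S_d, [forall j, g j <= f (p j)]%N].
  exact: below_perm gp.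
rewrite /plucker /determinant big1 ?eqxx // => p _.
have /forallPn [j gj] := np p; apply/eqP; rewrite mulf_eq0; apply/orP; right.
apply/prodf_eq0; exists j => //; rewrite mxE.
by apply: contraNT gj; exact: B0.
Qed.

(* A nonzero coordinate with the largest sum of entries: after normalising the
   rows [f] of [A] to the identity, every nonzero entry lies above its pivot. *)
Lemma echelon A : \rank A = d -> exists f : {ffun 'I_d -> 'I_n},
  plucker A f != 0 /\
  forall g, plucker A g != 0 -> below g f.
Proof.
move=> rA; have [f0 nz0] := rank_plucker rA.
pose f := [arg max_(f > f0 | plucker A (f : {ffun 'I_d -> 'I_n}) != 0)
  (\sum_j f j)%N].
have : plucker A f != 0 /\ forall g : {ffun 'I_d -> 'I_n}, plucker A g != 0 ->
    (\sum_j g j <= \sum_j f j)%N.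
  by rewrite /f; case: arg_maxnP => // i nzi mi; split=> // g /mi.
move: {nz0}f => f [nz fmax]; exists f; split=> // g nzg.
pose B := A *m invmx (rowsub f A).
have B0 r k : B r k != 0 -> (r <= f k)%N.
  rewrite plucker_normalized // mulf_eq0 negb_or => /andP [/fmax + _].
  rewrite (bigD1 k) //= [X in (_ <= X)%N](bigD1 k) //= ffunE eqxx.
  rewrite (eq_bigr (fun j => f j : nat)) ?leq_add2r // => j jk.
  by rewrite ffunE (negPf jk).
have : plucker B g != 0 by rewrite plucker_mulr det_inv mulf_neq0 // invr_eq0.
exact: plucker_below.
Qed.

End Echelon.

(** * Combinatorics of symbols *)

Section Combinatorics.
Variables (n d : nat).
Implicit Types f g h : 'I_d -> 'I_n.

Lemma below_sum f g : below f g -> (\sum_j f j <= \sum_j g j)%N.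
Proof. by move=> fg; rewrite !count_ge_sum; apply: leq_sum => x _;
  exact: fg. Qed.

Lemma count_ge0 f : count_ge 0 f = d.
Proof. by rewrite /count_ge sum_nat_const card_ord muln1. Qed.

Lemma count_ge_ge x f : (n <= x)%N -> count_ge x f = 0%N.
Proof.
by move=> nx; apply: big1 => j _; rewrite leqNgt (leq_trans (ltn_ord _) nx).
Qed.

(** Termwise inequalities between counts whose sums agree are equalities. Level 0 is separate
    because the layer-cake formula starts at level 1. *)
Lemma below_sum_ge f g : below f g -> (\sum_j g j <= \sum_j f j)%N ->
  forall x, count_ge x f = count_ge x g.
Proof.
move=> fg gf [|x]; first by rewrite !count_ge0.
have [nx|xn] := leqP n x; first by rewrite !count_ge_ge // leqW.
have /leqif_sum := fun (i : 'I_n) (_ : true) => leqif_eq (fg i.+1).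
rewrite -!count_ge_sum => -[_].
by rewrite eqn_leq gf below_sum // => /esym/forallP/(_ (Ordinal xn))/eqP.
Qed.

Definition increasing f := forall i j : 'I_d, (i < j)%N -> (f i < f j)%N.

Lemma increasing_inj f : increasing f -> injective f.
Proof.
move=> fI i j e; apply: val_inj; case: (ltngtP i j) => // /fI;
  by rewrite e ltnn.
Qed.

Lemma injective_sort f : injective f -> exists p : 'S_d, increasing (f \o p).
Proof.
(* The sorting permutation is the inverse of the rank, the number of smaller entries. *)
move=> fI; pose rk j := #|[set i | f i < f j]%N|.
have rk_mono i j : (f i < f j)%N -> (rk i < rk j)%N.
  move=> fij; apply: proper_card; apply/properP; split.
    by apply/fintype.subsetP => l; rewrite !inE => /ltn_trans; exact.
  by exists i; rewrite !inE ?fij ?ltnn.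
have rk_lt j : (rk j < d)%N.
  rewrite -[X in (_ < X)%N](card_ord d) -cardsT; apply: proper_card;
    apply/properP.
  by split; [exact: finset.subsetT | exists j; rewrite !inE ?ltnn].
have qI : injective (fun j => Ordinal (rk_lt j)).
  move=> i j [] rij; apply: fI; apply: val_inj.
  by case: (ltngtP (f i) (f j)) => // /rk_mono; rewrite rij ltnn.
exists (perm qI)^-1%g => i j /=.
have rkE l : rk ((perm qI)^-1%g l) = l by rewrite -[in RHS](permKV (perm qI) l)
  permE.
rewrite -(rkE i) -(rkE j); apply: contraTT; rewrite -!leqNgt leq_eqVlt.
by move=> /predU1P [/val_inj/fI ->//|/rk_mono/ltnW].
Qed.

Lemma increasing_gap f (i j : 'I_d) : increasing f -> (i <= j)%N ->
  (f i + (j - i) <= f j)%N.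
Proof.
move=> fI; case: j => m; elim: m => [|m IH] md /= ij.
  have -> : i = Ordinal md by apply/eqP; rewrite -val_eqE /= -leqn0.
  by rewrite sub0n addn0.
move: ij; rewrite leq_eqVlt => /predU1P [ij|ij].
  have -> : i = Ordinal md by exact: val_inj.
  by rewrite subnn addn0.
rewrite subSn // addnS; apply: leq_ltn_trans (IH (ltnW md) ij) _.
exact: fI.
Qed.

(** If [g j < f j], then at level [f j] all entries of [f] from [j] on are counted, but at most the
    entries of [g] after [j]. *)
Lemma increasing_below f g : increasing f -> increasing g -> below f g ->
  forall j, (f j <= g j)%N.
Proof.
move=> fI gI fg j; rewrite leqNgt; apply/negP => gf.
have := fg (f j); apply/negP; rewrite -ltnNge.
have mono h (i l : 'I_d) : increasing h -> (i <= l)%N -> (h i <= h l)%N.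
  by move=> hI; rewrite leq_eqVlt => /predU1P [/val_inj ->//|/hI/ltnW].
rewrite /count_ge (bigD1 j) //= [in X in (_ < X)%N](bigD1 j) //= leqnn
  [(f j <= g j)%N]leqNgt gf /=.
rewrite add0n add1n ltnS; apply: leq_sum => i ij.
have [ji|ji] := leqP j i; first by rewrite (mono _ _ _ fI ji) leq_b1.
rewrite [(f j <= g i)%N]leqNgt (leq_ltn_trans _ gf) //; apply: mono => //;
  exact: ltnW.
Qed.

Lemma sum_perm f (p : 'S_d) : (\sum_j (f \o p) j = \sum_j f j)%N.
Proof. by rewrite [RHS](reindex_inj (@perm_inj _ p)). Qed.

Lemma injective_sum f : injective f -> (\sum_(k < d) k <= \sum_j f j)%N.
Proof.
move=> /injective_sort [p pI]; rewrite -(sum_perm f p); apply: leq_sum => k _.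
have d0 : (0 < d)%N by apply: leq_trans (ltn_ord k).
have := @increasing_gap _ (Ordinal d0) k pI isT.
by rewrite subn0 => /(leq_trans _); apply; rewrite leq_addl.
Qed.

Definition lowerable f (k : 'I_d) (r : 'I_n) :=
  (f k == r.+1 :> nat) && [forall j, f j != r].

(** When no entry can be lowered, the set of values is closed downwards, hence equal to
    [0, ..., d - 1]. *)
Lemma not_lowerable_sum f : injective f -> (forall k r, ~~ lowerable f k r) ->
  (\sum_j f j = \sum_(k < d) k)%N.
Proof.
move=> fI nl.
have im k x : (x <= f k)%N -> x \in [seq val (f j) | j : 'I_d].
  move=> xf; rewrite -(subKn xf); elim: (f k - x)%N => [|m IH].
    by rewrite subn0; apply/mapP; exists k; rewrite ?mem_enum.
  have /mapP [j _ /= e] := IH.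
  rewrite subnS; case: (val (f k) - m)%N e => [|y] /= e.
    by apply/mapP; exists j; rewrite ?mem_enum.
  have yn : (y < n)%N by rewrite (leq_trans _ (ltn_ord (f j))) // -e.
  have := nl j (Ordinal yn); rewrite /lowerable -e eqxx /= => /forallPn [u].
  by rewrite negbK => /eqP fu; apply/mapP; exists u; rewrite ?mem_enum ?fu.
(* All values up to [f k] occur, so the count drops by one at each of these levels, starting from
   [d]. *)
have fd k : (f k < d)%N.
  have : forall m, (m <= (f k).+1)%N -> count_ge 0 f = (count_ge m f + m)%N.
    elim=> [|m IH] mf; first by rewrite addn0.
    by rewrite IH 1?ltnW // count_geS // (im k) //= addn1 addSnnS.
  by move=> /(_ _ (leqnn _)); rewrite count_ge0 => ->;
    rewrite addnS ltnS leq_addl.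
(* In sorted order the entry at [k] is at least [k], and at most [k] because the last entry is below
   [d]. *)
have [p pI] := injective_sort fI; rewrite -(sum_perm f p).
apply: eq_bigr => k _; apply/eqP; rewrite eqn_leq.
have d0 : (0 < d)%N by apply: leq_trans (ltn_ord k).
have d1 : (d.-1 < d)%N by rewrite prednK.
have := @increasing_gap _ (Ordinal d0) k pI isT.
rewrite /= subn0 => /(leq_trans (leq_addl _ _)) ->; rewrite andbT.
have kd : (k <= d.-1)%N by rewrite -ltnS prednK.
have := @increasing_gap _ k (Ordinal d1) pI kd.
move=> /leq_trans/(_ (_ : _ <= k + (d.-1 - k))%N); rewrite leq_add2r; apply.
by rewrite subnKC // -ltnS prednK // fd.
Qed.

Section Lower.
Variables (f : 'I_d -> 'I_n) (k : 'I_d) (r : 'I_n).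
Hypotheses (fI : injective f) (fk : lowerable f k r).

Let fkr : f k = r.+1 :> nat. Proof. by have /andP [/eqP] := fk. Qed.
Let fr j : f j != r. Proof. by have /andP [_ /forallP] := fk. Qed.

Lemma lower_inj : injective (update f k r).
Proof.
move=> i j; rewrite !ffunE; case: eqP => [->|ik]; case: eqP => [->|jk] // e.
- by have := fr j; rewrite -e eqxx.
- by have := fr i; rewrite e eqxx.
- exact: fI.
Qed.

Lemma lower_sum : (\sum_j f j = (\sum_j update f k r j).+1)%N.
Proof.
rewrite (bigD1 k) //= [in RHS](bigD1 k) //= ffunE eqxx fkr addSn.
by congr (_ + _).+1; apply: eq_bigr => j jk; rewrite ffunE (negPf jk).
Qed.

Lemma count_ge_lower x : count_ge x f =
  (count_ge x (update f k r) + (x == r.+1))%N.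
Proof.
rewrite /count_ge (bigD1 k) //= [in RHS](bigD1 k) //= ffunE eqxx fkr.
rewrite addnAC (leq_eqVlt x) ltnS; congr addn; last first.
  by apply: eq_bigr => j jk; rewrite ffunE (negPf jk).
by case: eqP => [->|_] /=; rewrite ?ltnn ?addn0.
Qed.

Lemma lower_below : below (update f k r) f.
Proof. by move=> x; rewrite (count_ge_lower x) leq_addr. Qed.

Lemma not_below_lower : ~ below f (update f k r).
Proof. by move=> /(_ r.+1); rewrite count_ge_lower eqxx addn1 ltnn. Qed.

(** The count of [f] drops by one after level [r + 1], since [f] takes that value, while that of the
    injective [g] drops by at most one. The bound at the next level thus passes down to [r + 1]. *)
Lemma below_near g h : injective g -> below h f ->
  (forall x, x != r.+1 -> count_ge x g = count_ge x h) -> below g f.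
Proof.
move=> gI hf gh x; have [->|xr] := eqVneq x r.+1; last by rewrite gh.
have -> : count_ge r.+1 f = (count_ge r.+2 f).+1.
  rewrite count_geS // (_ : _ \in _) ?addn1 //.
  by apply/mapP; exists k; rewrite ?mem_enum.
by rewrite (count_geS _ gI)
  gh ?gtn_eqF // -[X in (_ <= X)%N]addn1 leq_add ?hf ?leq_b1.
Qed.

End Lower.
End Combinatorics.

(** * Coordinates under mixing of two adjacent rows *)

Section LowerPlucker.
Variables (F : fieldType) (n d : nat).
Implicit Types (A B : 'M[F]_(n, d)) (g : 'I_d -> 'I_n).
Variables (f : 'I_d -> 'I_n) (k : 'I_d) (r : 'I_n).
Hypotheses (fI : injective f) (fk : lowerable f k r).

Definition supp_below A g := forall h, plucker A h != 0 -> below h g.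

Let fkr : f k = r.+1 :> nat. Proof. by have /andP [/eqP] := fk. Qed.
Let fr j : f j == r = false.
Proof. by apply/negbTE; have /andP [_ /forallP] := fk. Qed.
Let ffk j : j != k -> f j == f k = false.
Proof. by move=> jk; apply/negbTE; rewrite (inj_eq fI). Qed.

Lemma plucker_lower0 A : supp_below A (update f k r) -> plucker A f = 0.
Proof.
move=> sA; apply/eqP; apply: contra_notT (not_below_lower fk); exact: sA.
Qed.

(** Since [r] is not a value of [f], only one row of the minor changes, and linearity in that row
    applies. *)
Lemma plucker_mix_rows_top A x y z t :
  plucker (mix_rows r (f k) x y z t *m A) f = z * plucker A (update f k r)
    + t * plucker A f.
Proof.
have <- : plucker A (update f k (f k)) = plucker A f.
  by apply: eq_plucker => j; rewrite ffunE; case: eqP => [->|].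
apply: plucker_linear => [|j jk]; rewrite row_mix_rows_mul ?fr ?eqxx //.
by rewrite ffk.
Qed.

Lemma plucker_mix_rows_lower A x y z t :
  plucker (mix_rows r (f k) x y z t *m A)
    (update f k r) = x * plucker A (update f k r) + y * plucker A f.
Proof.
have -> : plucker A (update f k r) = plucker A (update (update f k r) k r).
  by apply: eq_plucker => j; rewrite !ffunE; case: eqP.
have -> : plucker A f = plucker A (update (update f k r) k (f k)).
  by apply: eq_plucker => j; rewrite !ffunE; case: eqP => [->|].
apply: plucker_linear => [|j jk]; rewrite row_mix_rows_mul ffunE.
  by rewrite !eqxx.
by rewrite (negPf jk) fr ffk.
Qed.

(** A tuple [h] contributing to coordinate [g] differs from it only where both take values among [r]
    and [r + 1], so the counts agree at every level but [r + 1]. *)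
Lemma mix_rows_supp A x y z t : supp_below A f ->
  supp_below (mix_rows r (f k) x y z t *m A) f.
Proof.
move=> sA g nz; have gI := plucker_inj nz; move: nz; rewrite plucker_mul => nz.
have [h] : exists h : {ffun 'I_d -> 'I_n},
    (\prod_i mix_rows r (f k) x y z t (g i) (h i)) * plucker A h != 0.
  apply/existsP; apply: contraNT nz => /existsPn h0.
  by rewrite big1 // => h _; apply/eqP; rewrite -[_ == _]negbK.
rewrite mulf_eq0 negb_or => /andP [/prodf_neq0 bn /sA hf].
apply: (below_near fI fk gI hf) => l lr; apply: eq_bigr => i _;
  congr nat_of_bool.
have [->//|] := mix_rows_entry (bn i isT).
rewrite !inE => -[gi hi].
have E (u : 'I_n) : (u == r) || (u == f k) -> (l <= u)%N = (l <= r)%N.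
  case/orP=> /eqP -> //; rewrite fkr leq_eqVlt ltnS.
  by rewrite (negPf lr).
by rewrite !E.
Qed.

(** The tuple [g] of the echelon form lies between the lowered tuple and [f]. If its count at
    [r + 1] were that of [f], all counts would agree and coordinate [g] would be, up to sign, the
    vanishing coordinate [f]. *)
Lemma supp_lower A : \rank A = d -> supp_below A f ->
  plucker A f = 0 -> plucker A (update f k r) != 0 ->
    supp_below A (update f k r).
Proof.
move=> rA sA A0 nz; have [g [nzg sg]] := echelon rA.
suff gf : below g (update f k r) by move=> h /sg; move/below_trans; apply.
have gf := sA _ nzg; have fg := sg _ nz; have gI := plucker_inj nzg.
move=> x; have := gf x; rewrite (count_ge_lower fk); have [xr|] :=
  eqVneq x r.+1; last by rewrite addn0.
rewrite addn1 leq_eqVlt ltnS => /predU1P [e|//].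
have [y|p /eq_plucker pE] := count_ge_image fI gI (g := g).
  have [->|yr] := eqVneq y r.+1.
    by rewrite -xr e (count_ge_lower fk) xr eqxx addn1.
  apply/eqP; rewrite eqn_leq gf andbT (count_ge_lower fk) (negPf yr) addn0.
  exact: fg.
by move: nzg; rewrite pE plucker_perm A0 mulr0 eqxx.
Qed.

End LowerPlucker.

Lemma mul_mix_rows (F : comNzRingType) n (r s : 'I_n)
  (x y z t x' y' z' t' : F) : r != s ->
  mix_rows r s x y z t *m mix_rows r s x' y' z' t' =
    mix_rows r s (x * x' + y * z') (x * y' + y * t') (z * x' + t * z')
      (z * y' + t * t').
Proof.
move=> rs; have sr : s == r = false by rewrite eq_sym (negPf rs).
apply/row_matrixP => i; rewrite row_mix_rows_mul; apply/rowP => j.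
case: ifP => ir; last case: ifP => is_; rewrite !mxE ?ir ?is_ ?eqxx ?sr //.
  by rewrite !mulrDr !mulrnAr addrACA -!mulrnDl.
by rewrite !mulrDr !mulrnAr addrACA -!mulrnDl.
Qed.

Lemma mix_rows1 (F : comNzRingType) n (r s : 'I_n) : r != s ->
  mix_rows r s 1 0 0 1 = 1%:M :> 'M[F]_n.
Proof.
move=> rs; apply/matrixP => i j; rewrite !mxE !mul0rn add0r addr0.
case: eqP => [->|_]; first by rewrite eq_sym.
by case: eqP => [->|//]; rewrite eq_sym.
Qed.

(** * Row rotations *)

Section Norm.
Variables (C : numClosedFieldType) (n d : nat).
Implicit Types (A B : 'M[C]_(n, d)).

(** Summing over all tuples counts each set of rows [d!] times, a harmless constant factor. *)
Definition plucker_sqnorm A : C := \sum_(g : {ffun 'I_d -> 'I_n})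
  `|plucker A g| ^+ 2.

Lemma plucker_sqnorm_gt0 A : \rank A = d -> 0 < plucker_sqnorm A.
Proof.
move=> /rank_plucker [f nz]; rewrite /plucker_sqnorm (bigD1 f) //= ltr_wpDr //.
  by apply: sumr_ge0 => g _; rewrite exprn_ge0.
by rewrite exprn_gt0 // normr_gt0.
Qed.

Lemma plucker_sqnorm_unitary (S : 'M[C]_n) A : (map_mx Num.conj S)^T *m S =
  1%:M ->
  plucker_sqnorm (S *m A) = plucker_sqnorm A.
Proof.
move=> SS.
have Sjl j l : \sum_i (S i j)^* * S i l = (j == l)%:R.
  have /matrixP/(_ j l) := SS; rewrite !mxE => <-.
  by apply: eq_bigr => i _; rewrite !mxE.
rewrite /plucker_sqnorm.
transitivity (\sum_(g : {ffun 'I_d -> 'I_n}) \sum_(h : {ffun 'I_d -> 'I_n})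
  (\sum_(f : {ffun 'I_d -> 'I_n}) \prod_i ((S (f i) (g i))^* * S (f i) (h i)))
   * ((plucker A g)^* * plucker A h)).
  under [RHS]eq_bigr do under eq_bigr do rewrite mulr_suml.
  under [RHS]eq_bigr do rewrite exchange_big /=.
  rewrite [RHS]exchange_big /=; apply: eq_bigr => f _.
  rewrite normCKC plucker_mul rmorph_sum /= big_distrlr /=.
  apply: eq_bigr => g _; apply: eq_bigr => h _.
  by rewrite rmorphM rmorph_prod big_split /= mulrACA.
(* The sum over [f] factors into inner products of columns of [S], which are orthonormal. *)
have D (g h : {ffun 'I_d -> 'I_n}) :
    \sum_(f : {ffun 'I_d -> 'I_n}) \prod_i ((S (f i) (g i))^* * S (f i) (h i)) =
    \prod_i (g i == h i)%:R.
  under [RHS]eq_bigr do rewrite -Sjl.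
  by rewrite (bigA_distr_bigA (fun i j => (S j (g i))^* * S j (h i))).
apply: eq_bigr => g _; rewrite (bigD1 g) //= [X in _ + X]big1 ?addr0 => [|h hg].
  by rewrite D big1 ?mul1r ?normCKC // => i _; rewrite eqxx.
have [i ghi] : exists i, g i != h i.
  apply/existsP; apply: contraNT hg => /existsPn gh.
  by apply/eqP/ffunP => i; apply/esym/eqP; rewrite -[_ == _]negbK.
by rewrite D (bigD1 i) //= (negPf ghi) !mul0r.
Qed.

Definition rowrot (r s : 'I_n) (z q : C) : 'M[C]_n := mix_rows r s z (- q)
  q z^*.

Section Rot.
Variables (r s : 'I_n) (rs : r != s).

Lemma rowrot_adjoint z q : q \is Num.real ->
  (map_mx Num.conj (rowrot r s z q))^T = mix_rows r s z^* q (- q) z.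
Proof.
move=> /CrealP qJ; have sr : s == r = false by rewrite eq_sym (negPf rs).
apply/matrixP => i j; rewrite !mxE.
have [ir|ir] := eqVneq i r; [|have [is_|is_] := eqVneq i s];
  (have [jr|jr] := eqVneq j r; [|have [js|js] := eqVneq j s]);
  rewrite ?ir ?is_ ?jr ?js ?eqxx ?sr ?(negPf rs) ?(negPf ir) ?(negPf is_)
    ?(negPf jr) ?(negPf js)
    ?mulr0n ?mulr1n ?add0r ?addr0 ?rmorphN ?rmorph0 ?conjCK ?qJ //=.
- by rewrite qJ.
- by rewrite eq_sym rmorph_nat.
Qed.

Section Unitary.
Variables (z q : C).
Hypotheses (qR : q \is Num.real) (zq : `|z| ^+ 2 + q ^+ 2 = 1).

Lemma rowrot_adjoint_mul : mix_rows r s z^* q (- q) z *m rowrot r s z q = 1%:M.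
Proof.
rewrite mul_mix_rows // -[RHS](mix_rows1 _ rs); congr mix_rows.
- by rewrite -normCKC -expr2.
- by rewrite mulrN mulrC addrC subrr.
- by rewrite mulNr mulrC addrC subrr.
- by rewrite mulrNN -normCK addrC -expr2.
Qed.

Lemma rowrot_mul_adjoint : rowrot r s z q *m mix_rows r s z^* q (- q) z = 1%:M.
Proof. exact: mulmx1C rowrot_adjoint_mul. Qed.

Lemma plucker_sqnorm_rowrot A :
  plucker_sqnorm (rowrot r s z q *m A) = plucker_sqnorm A.
Proof. by apply: plucker_sqnorm_unitary;
  rewrite rowrot_adjoint // rowrot_adjoint_mul. Qed.

End Unitary.

(** Charts are defined for every parameter, and outside the unit disc the rotation need not be
    unitary; its adjoint divided by [c] is still an inverse. *)
Lemma rowrot_unit z q : q \is Num.real -> `|z| ^+ 2 + q ^+ 2 != 0 ->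
  rowrot r s z q \in unitmx.
Proof.
move=> qR; set c := _ + _ => c0.
suff : rowrot r s z q *m mix_rows r s (z^* / c) (q / c) (- q / c)
  (z / c) = 1%:M.
  by case/mulmx1_unit.
rewrite mul_mix_rows // -[RHS](mix_rows1 _ rs); congr mix_rows.
- by rewrite !mulrA -mulrDl mulrNN -normCK -expr2 divff.
- by rewrite !mulrA -mulrDl mulNr [q * z]mulrC subrr mul0r.
- by rewrite !mulrA -mulrDl mulrN [z^* * q]mulrC subrr mul0r.
- by rewrite !mulrA -mulrDl -normCKC -expr2 addrC divff.
Qed.

End Rot.

Section Lower.
Variables (f : 'I_d -> 'I_n) (k : 'I_d) (r : 'I_n).
Hypotheses (fI : injective f) (fk : lowerable f k r).
Local Notation f' := (update f k r).

Lemma lowerable_neq : r != f k.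
Proof. by apply/eqP => rk; have /andP [/eqP] := fk; rewrite -rk => /n_Sn. Qed.

Let rs := lowerable_neq.

Lemma rowrot_inj A A' z q z' q' :
  q \is Num.real -> q' \is Num.real ->
  `|z| ^+ 2 + q ^+ 2 = 1 -> `|z'| ^+ 2 + q' ^+ 2 = 1 ->
  supp_below A f' -> supp_below A' f' -> 0 < plucker A f' ->
    0 < plucker A' f' ->
  (forall g, plucker (rowrot r (f k) z q *m A) g =
    plucker (rowrot r (f k) z' q' *m A') g) ->
  z = z' /\ forall g, plucker A g = plucker A' g.
Proof.
move=> qR q'R zq zq' sA sA' p0 p0' e.
have := e f'; have := e f.
rewrite !plucker_mix_rows_top // !plucker_mix_rows_lower //
  (plucker_lower0 fk sA) (plucker_lower0 fk sA').
rewrite !mulr0 !addr0 => eq_ ez.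
(* The rotated matrix has coordinates [q * p] at [f] and [z * p] at [f'], where [p] is the old
   coordinate at [f']; their squared moduli add up to [p ^ 2]. *)
have pp : plucker A f' = plucker A' f'.
  have nM (x y : C) : 0 < y -> `|x| * y = `|x * y| by move=> /gtr0_norm {1}<-;
    rewrite normrM.
  apply/eqP; rewrite -(@eqrXn2 _ 2)
    ?ltW // -[X in X == _]mul1r -[X in _ == X]mul1r.
  by rewrite -{1}zq -zq' !mulrDl -!exprMn !nM // ez eq_.
have pn0 : plucker A f' != 0 by rewrite gt_eqF.
have zz : z = z' by apply: (mulIf pn0); rewrite ez pp.
have qq : q = q' by apply: (mulIf pn0); rewrite eq_ pp.
(* With equal parameters the same inverse rotation undoes both sides. *)
split=> // g.
rewrite -[A]mul1mx -[A']mul1mx -(rowrot_adjoint_mul rs zq) -!mulmxA.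
rewrite [in LHS]plucker_mul [in RHS]plucker_mul zz qq.
by apply: eq_bigr => h _; rewrite -e zz qq.
Qed.

(* The angle is chosen so that the inverse rotation of [B] has coordinate [f]
   equal to 0. *)
Lemma rowrot_surj B : \rank B = d -> supp_below B f -> 0 < plucker B f ->
  exists z q A, [/\ 0 < q, `|z| ^+ 2 + q ^+ 2 = 1, B = rowrot r (f k) z q *m A,
    \rank A = d & supp_below A f' /\ 0 < plucker A f'].
Proof.
move=> rB sB b0; set a := plucker B f'; set b := plucker B f.
pose m2 := `|a| ^+ 2 + b ^+ 2; pose m := sqrtC m2.
have m20 : 0 < m2 by rewrite ltr_wpDl ?exprn_ge0 ?exprn_gt0.
have m0 : 0 < m by rewrite sqrtC_gt0.
have q0 : 0 < b / m by rewrite divr_gt0.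
have qR : b / m \is Num.real by rewrite realE ltW.
have zq : `|a / m| ^+ 2 + (b / m) ^+ 2 = 1.
  rewrite normrM normfV (gtr0_norm m0) !expr_div_n -mulrDl sqrtCK divff //.
  by rewrite gt_eqF.
exists (a / m), (b / m), (mix_rows r (f k) (a / m)^* (b / m) (- (b / m))
  (a / m) *m B).
set A := _ *m B; have BA : B = rowrot r (f k) (a / m) (b / m) *m A.
  by rewrite mulmxA rowrot_mul_adjoint // mul1mx.
have sA : supp_below A f by apply: mix_rows_supp.
have p0 : 0 < plucker A f'.
  have mJ : (a / m)^* = a^* / m
    by rewrite rmorphM fmorphV /= (CrealP (gtr0_real m0)).
  rewrite plucker_mix_rows_lower // mJ [_ / m * _]mulrAC -normCKC
    [b / m * _]mulrAC -expr2.
  by rewrite -mulrDl divr_gt0.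
have rA : \rank A = d by apply: plucker_rank (lt0r_neq0 p0).
split=> //; split=> //; apply: (supp_lower fI fk rA sA); last exact: lt0r_neq0.
by rewrite plucker_mix_rows_top // mulNr mulrAC [a / m * b]mulrAC [b * a]mulrC
  addrC subrr.
Qed.

End Lower.

Definition basemx (f : 'I_d -> 'I_n) : 'M[C]_(n, d) := \matrix_(i, k)
  (i == f k)%:R.

Lemma plucker_basemx (f : 'I_d -> 'I_n) : injective f -> plucker (basemx f) f =
  1.
Proof.
move=> fI; rewrite /plucker (_ : rowsub _ _ = 1%:M) ?det1 //.
by apply/matrixP => i j; rewrite !mxE (inj_eq fI).
Qed.

Lemma basemx_supp f : supp_below (basemx f) f.
Proof.
move=> g; apply: plucker_below => r k; rewrite mxE.
by have [-> //|_] := eqVneq r (f k); rewrite eqxx.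
Qed.

(** The sum of [f] is minimal, so an injective tuple below [f] is a permutation of it and the
    coordinates of [B] are proportional to those of the base point. Norm and positivity make the
    factor 1. *)
Lemma basemx_surj (f : 'I_d -> 'I_n) B : injective f ->
  (\sum_j f j = \sum_(k < d) k)%N ->
  supp_below B f -> 0 < plucker B f -> plucker_sqnorm B =
    plucker_sqnorm (basemx f) ->
  forall g, plucker (basemx f) g = plucker B g.
Proof.
move=> fI fb sB b0 NB.
have E g : plucker B g = plucker B f * plucker (basemx f) g.
  have K : injective g -> below g f -> plucker B g =
    plucker B f * plucker (basemx f) g.
    move=> gI gf; have [|p pE] := count_ge_image fI gI.
      by move=> x; apply/esym/below_sum_ge; rewrite ?fb ?injective_sum.
    by rewrite !(eq_plucker _ pE) !plucker_perm plucker_basemx // mulr1 mulrC.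
  have [B0|B0] := eqVneq (plucker B g) 0; last by apply: K;
    [exact: plucker_inj B0|exact: sB].
  have [E0|E0] := eqVneq (plucker (basemx f) g) 0; first by rewrite B0 E0 mulr0.
  by apply: K; [exact: plucker_inj E0|exact: basemx_supp].
have N0 : plucker_sqnorm (basemx f) != 0.
  rewrite gt_eqF // plucker_sqnorm_gt0 //; apply: (@plucker_rank _ _ _ _ f).
  by rewrite plucker_basemx // oner_eq0.
have : (plucker B f) ^+ 2 = 1.
  apply: (mulIf N0); rewrite mul1r -[RHS]NB /plucker_sqnorm mulr_sumr.
  by apply: eq_bigr => g _; rewrite (E g) normrM exprMn (gtr0_norm b0).
move=> /eqP; rewrite sqrp_eq1 ?ltW // => /eqP b1 g.
by rewrite (E g) b1 mul1r.
Qed.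

End Norm.

Local Open Scope classical_set_scope.
Local Open Scope ring_scope.
Local Open Scope complex_scope.
Local Open Scope quotient_scope.

(** * Continuity *)

Section MatrixContinuity.
Variables (K : numFieldType) (T : topologicalType).

Lemma continuous_sum (I : Type) (r : seq I) (P : pred I) (F : I -> T -> K) :
  (forall i, P i -> continuous (F i)) ->
  continuous (fun x => \sum_(i <- r | P i) F i x).
Proof.
move=> cF; elim: r => [|i r IH].
  under eq_fun do rewrite big_nil.
  by move=> x; exact: cvg_cst.
under eq_fun do rewrite big_cons.
case Pi: (P i) => // x.
by apply: cvgD; [exact: cF | exact: IH].
Qed.

Lemma continuous_prod (I : Type) (r : seq I) (P : pred I) (F : I -> T -> K) :
  (forall i, P i -> continuous (F i)) ->
  continuous (fun x => \prod_(i <- r | P i) F i x).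
Proof.
move=> cF; elim: r => [|i r IH].
  under eq_fun do rewrite big_nil.
  by move=> x; exact: cvg_cst.
under eq_fun do rewrite big_cons.
case Pi: (P i) => // x.
by apply: cvgM; [exact: cF | exact: IH].
Qed.

Lemma continuous_mx m n (f : T -> 'M[K]_(m, n)) :
  (forall i j, continuous (fun x => f x i j)) -> continuous f.
Proof.
move=> cf x A [P Pn PA].
have : \forall y \near x, forall i j, P i j (f y i j).
  by apply: filter_forall => i; apply: filter_forall => j; exact: cf.
by apply: filterS => y Py; exact: PA.
Qed.

Lemma continuous_entry m n (f : T -> 'M[K]_(m, n)) i j :
  continuous f -> continuous (fun x => f x i j).
Proof.
move=> cf x; apply: (@continuous_comp _ _ _ f (fun M : 'M[K]_(m, n) => M i j)).
  exact: cf.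
exact: coord_continuous.
Qed.

Lemma continuous_mulmx m n p (f : T -> 'M[K]_(m, n)) (g : T -> 'M[K]_(n, p)) :
  continuous f -> continuous g -> continuous (fun x => f x *m g x).
Proof.
move=> cf cg; apply: continuous_mx => i j.
under eq_fun do rewrite mxE.
by apply: continuous_sum => k _ x; apply: cvgM; exact: continuous_entry.
Qed.

Lemma continuous_plucker n d (f : T -> 'M[K]_(n, d)) (g : 'I_d -> 'I_n) :
  continuous f -> continuous (fun x => plucker (f x) g).
Proof.
move=> cf; apply: continuous_sum => s _ x; apply: cvgM; first exact: cvg_cst.
apply: (continuous_prod (F := fun i y => (rowsub g (f y)) i (s i))) => i _ y.
under eq_fun do rewrite mxE.
exact: continuous_entry.
Qed.

Lemma continuous_mix_rows n (r1 r2 : 'I_n) (x y z t : T -> K) :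
  continuous x -> continuous y -> continuous z -> continuous t ->
  continuous (fun s => mix_rows r1 r2 (x s) (y s) (z s) (t s)).
Proof.
have cMn (u : T -> K) b : continuous u -> continuous (fun s => u s *+ b).
  move=> cu; under eq_fun do rewrite -mulr_natr.
  by move=> s; exact: (cvgM (cu s) (cvg_cst (b%:R : K))).
move=> cx cy cz ct; apply: continuous_mx => i j.
under eq_fun do rewrite mxE.
case: (i == r1); first by move=> s; exact: (cvgD (cMn _ _ cx s) (cMn _ _ cy s)).
case: (i == r2); first by move=> s; exact: (cvgD (cMn _ _ cz s) (cMn _ _ ct s)).
exact: cst_continuous.
Qed.

End MatrixContinuity.

(** * Continuity over the complex numbers and the rotation parameter *)

Section ComplexTopology.
Variable R : realType.
Local Notation C := R[i].

Lemma Re_continuous : continuous (fun z : C => complex.Re z : R).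
Proof.
move=> z A /nbhs_ballP [e e0 eA]; apply/nbhs_ballP; exists e%:C.
  by rewrite /= ltcR.
move=> t; rewrite -ball_normE /= => zt; apply: eA; rewrite -ball_normE /=.
rewrite -raddfB -ltcR; apply: le_lt_trans zt; exact: normc_ge_Re.
Qed.

Lemma real_complex_continuous : continuous (fun x : R => x%:C : C).
Proof.
(* The radius [e] is complex; [0 < e] makes its imaginary part zero, so its real part serves as a
   radius in [R]. *)
move=> x A /nbhs_ballP [e e0 eA]; apply/nbhs_ballP; exists (complex.Re e).
  by move: e0; rewrite /= ltcE => /andP [].
move=> t; rewrite -ball_normE /= => xt; apply: eA; rewrite -ball_normE /=.
rewrite -rmorphB /= normc_def /= expr0n addr0 sqrtr_sqr.
by move: e0 xt; case: e => er ei; rewrite !ltcE /= => /andP [/eqP -> _] ->;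
  rewrite eqxx.
Qed.

Lemma conj_continuous : continuous (fun z : C => z^* : C).
Proof.
move=> x A /nbhs_ballP [e e0 eA]; apply/nbhs_ballP; exists e => //.
move=> t; rewrite -ball_normE /= => xt; apply: eA; rewrite -ball_normE /=.
by rewrite -rmorphB /= norm_conjC.
Qed.

(* Outside the unit disc the square root of a negative number is 0, so that
   [rotsin] is defined and continuous everywhere. *)
Definition rotsin (z : C) : C := (Num.sqrt (1 - complex.Re (`|z| ^+ 2)))%:C.

Lemma rotsin_continuous : continuous rotsin.
Proof.
have c1 : continuous (fun z : C => `|z| ^+ 2 : C).
  have cn : continuous (fun z : C => `|z| : C) := @norm_continuous C C^o.
  by move=> z; exact: (cvgM (cn z) (cn z)).
have c2 : continuous (fun z : C => 1 - complex.Re (`|z| ^+ 2) : R).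
  move=> z; have cR := continuous_comp (c1 z) (@Re_continuous (`|z| ^+ 2)).
  exact: (cvgB (cvg_cst (1 : R)) cR).
have c3 : continuous (fun z : C => Num.sqrt (1 - complex.Re (`|z| ^+ 2)) : R).
  move=> z; exact: (continuous_comp (c2 z)
    (@sqrt_continuous R (1 - complex.Re (`|z| ^+ 2)))).
move=> z; exact: (continuous_comp (c3 z) (@real_complex_continuous _)).
Qed.

Lemma rotsin_real z : rotsin z \is Num.real.
Proof. by rewrite ger0_real // lecR sqrtr_ge0. Qed.

Lemma rotsin_sqr z : `|z| <= 1 -> `|z| ^+ 2 + rotsin z ^+ 2 = 1.
Proof.
move=> z1; have z2 : `|z| ^+ 2 <= 1 by rewrite exprn_ile1.
have z2E : `|z| ^+ 2 = (complex.Re (`|z| ^+ 2))%:C.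
  by rewrite RRe_real // ger0_real // exprn_ge0.
have -> : rotsin z ^+ 2 = (Num.sqrt (1 - complex.Re (`|z| ^+ 2)) ^+ 2)%:C.
  by rewrite rmorphXn.
rewrite sqr_sqrtr; last by rewrite subr_ge0 -lecR -z2E.
by rewrite rmorphB /= -z2E addrCA subrr addr0.
Qed.

Lemma rotsin_gt0 z : (0 < rotsin z) = (`|z| < 1).
Proof.
have z2E : `|z| ^+ 2 = (complex.Re (`|z| ^+ 2))%:C.
  by rewrite RRe_real // ger0_real // exprn_ge0.
rewrite /rotsin ltcR sqrtr_gt0 subr_gt0 -ltcR -z2E.
by rewrite expr_lt1.
Qed.

Lemma rotsin_ge0 z : 0 <= rotsin z.
Proof. by rewrite lecR sqrtr_ge0. Qed.

Lemma rotsin_uniq z q : 0 < q -> `|z| ^+ 2 + q ^+ 2 = 1 ->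
  `|z| < 1 /\ rotsin z = q.
Proof.
move=> q0 zq; have z1 : `|z| < 1.
  by rewrite -(@expr_lt1 _ 2) // -zq ltrDl exprn_gt0.
split=> //; apply/eqP; rewrite -(@eqrXn2 _ 2) ?rotsin_ge0 ?(ltW q0) //.
by rewrite -(inj_eq (addrI (`|z| ^+ 2))) zq rotsin_sqr // ltW.
Qed.

Lemma rotsin_neq0 z : `|z| ^+ 2 + rotsin z ^+ 2 != 0.
Proof.
have [z1|z1] := real_ltP (normr_real z) (real1 _).
  by rewrite rotsin_sqr ?oner_eq0 // ltW.
rewrite gt_eqF // ltr_pwDl ?exprn_ge0 ?rotsin_ge0 // exprn_gt0 //.
exact: lt_le_trans z1.
Qed.

End ComplexTopology.

(** * Polydisc charts *)

Section Chart.
Variables (R : realType) (n d : nat).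
Local Notation C := R[i].

Definition polydisc l (z : 'rV[C]_l) := forall i, `|z 0 i| < 1.

(** Rank, support and top coordinate are controlled for all parameters, hence on the boundary too;
    the norm, injectivity and surjectivity only on the open polydisc. The last two speak of
    coordinates, which fix a matrix only up to a right factor of determinant 1. *)
Record cell_chart (f : 'I_d -> 'I_n) (l : nat) := CellChart {
  chart_map : 'rV[C]_l -> 'M[C]_(n, d);
  chart_norm : C;
  chart_continuous : continuous chart_map;
  chart_rank : forall z, \rank (chart_map z) = d;
  chart_supp : forall z, supp_below (chart_map z) f;
  chart_top : forall z, plucker (chart_map z) f = \prod_i rotsin (z 0 i);
  chart_sqnorm : forall z, polydisc z ->
    plucker_sqnorm (chart_map z) = chart_norm;
  chart_inj : forall z z', polydisc z -> polydisc z' ->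
    (forall g, plucker (chart_map z) g = plucker (chart_map z') g) -> z = z';
  chart_surj : forall B, \rank B = d -> supp_below B f -> 0 < plucker B f ->
    plucker_sqnorm B = chart_norm ->
    exists2 z, polydisc z & forall g, plucker (chart_map z) g = plucker B g
}.

Arguments chart_continuous {f l} c.
Arguments chart_supp {f l} c z.
Arguments chart_inj {f l} c z z'.
Arguments chart_surj {f l} c B.

Section Base.
Variables (f : 'I_d -> 'I_n).
Hypotheses (fI : injective f) (fb : (\sum_j f j = \sum_(k < d) k)%N).

Definition base_chart : cell_chart f 0.
Proof.
apply: (@CellChart f 0 (fun _ => basemx C f) (plucker_sqnorm (basemx C f))).
- exact: (@cst_continuous _ _ (basemx C f)).
- by move=> _; apply: (@plucker_rank _ _ _ _ f);
  rewrite plucker_basemx // oner_eq0.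
- by move=> _; exact: basemx_supp.
- by move=> z; rewrite big_ord0 plucker_basemx.
- by [].
- by move=> z z' _ _ _; apply/rowP => -[].
- by move=> B rB sB B0 NB; exists 0 => [[]//|g]; exact: basemx_surj.
Defined.

End Base.

Section Step.
Variables (f : 'I_d -> 'I_n) (k : 'I_d) (r : 'I_n) (l : nat).
Hypotheses (fI : injective f) (fk : lowerable f k r).
Variable K : cell_chart (update f k r) l.

Let row_tl (z : 'rV[C]_l.+1) : 'rV[C]_l := \row_i z 0 (lift ord0 i).
Let row_cons (x : C) (z : 'rV[C]_l) : 'rV[C]_l.+1 :=
  \row_i oapp (fun j => z 0 j) x (unlift ord0 i).

Let rs : r != f k := lowerable_neq fk.

Definition step_map (z : 'rV[C]_l.+1) : 'M[C]_(n, d) :=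
  rowrot r (f k) (z 0 ord0) (rotsin (z 0 ord0)) *m chart_map K (row_tl z).

Lemma step_top z : plucker (step_map z) f = \prod_i rotsin (z 0 i).
Proof.
rewrite plucker_mix_rows_top // (plucker_lower0 fk (chart_supp K _))
  mulr0 addr0 chart_top.
by rewrite big_ord_recl; congr (_ * _); apply: eq_bigr => i _; rewrite mxE.
Qed.

Lemma plucker_chart_gt0 z : polydisc z -> 0 < plucker (chart_map K z)
  (update f k r).
Proof. by move=> zd; rewrite chart_top prodr_gt0 // => i _;
  rewrite rotsin_gt0. Qed.

Lemma polydisc_tl z : polydisc z -> polydisc (row_tl z).
Proof. by move=> zd i; rewrite mxE. Qed.

Definition step_chart : cell_chart f l.+1.
Proof.
apply: (@CellChart f l.+1 step_map (chart_norm K)).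
- apply: continuous_mulmx; last first.
    have cK := chart_continuous K.
    have ct : continuous row_tl.
      apply: continuous_mx => i j; under eq_fun do rewrite mxE.
      exact: coord_continuous.
    by move=> z; exact: (continuous_comp (ct z) (cK (row_tl z))).
  have c0 : continuous (fun z : 'rV[C]_l.+1 => z 0 ord0)
    by exact: coord_continuous.
  have cs : continuous (fun z : 'rV[C]_l.+1 => rotsin (z 0 ord0)).
    by move=> z; exact: (continuous_comp (c0 z)
      (@rotsin_continuous _ (z 0 ord0))).
  have cJ : continuous (fun z : 'rV[C]_l.+1 => (z 0 ord0)^*).
    by move=> z; exact: (continuous_comp (c0 z)
      (@conj_continuous _ (z 0 ord0))).
  have cN : continuous (fun z : 'rV[C]_l.+1 => - rotsin (z 0 ord0)).
    by move=> z; exact: (cvgN (cs z)).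
  exact: (continuous_mix_rows c0 cN cs cJ).
- move=> z; rewrite eqmxMfull ?chart_rank // row_full_unit rowrot_unit
  ?rotsin_real //.
  exact: rotsin_neq0.
- move=> z; apply: mix_rows_supp => // h; move=> /chart_supp; move/below_trans;
  apply.
  exact: lower_below.
- exact: step_top.
- move=> z zd; rewrite plucker_sqnorm_rowrot ?rotsin_real ?rotsin_sqr
  ?(ltW (zd _)) //.
  by rewrite chart_sqnorm //; exact: polydisc_tl.
- move=> z z' zd zd' e.
  have [ez eK] := rowrot_inj fI fk (rotsin_real _) (rotsin_real _)
    (rotsin_sqr (ltW (zd ord0))) (rotsin_sqr (ltW (zd' ord0)))
    (chart_supp K _) (chart_supp K _)
    (plucker_chart_gt0 (polydisc_tl zd)) (plucker_chart_gt0 (polydisc_tl zd'))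
      e.
  have /rowP et := chart_inj K _ _ (polydisc_tl zd) (polydisc_tl zd') eK.
  apply/rowP => i; case: (unliftP ord0 i) => [j ->|->//].
  by have := et j; rewrite !mxE.
(* Undoing the rotation found for [B] leaves a matrix of the same norm in the smaller cell, where
   the given chart applies. *)
- move=> B rB sB B0 NB; have [x [q [A [q0 xq BA rA [sA A0]]]]] :=
  rowrot_surj fI fk rB sB B0.
  have [x1 qE] := rotsin_uniq q0 xq.
  have [|z zd eA] := chart_surj K _ rA sA A0.
    by rewrite -NB BA plucker_sqnorm_rowrot // realE ltW.
  exists (row_cons x z).
    by move=> i; rewrite mxE; case: unlift => [j|] /=.
  move=> g; rewrite /step_map BA !mxE unlift_none /= qE.
  rewrite (plucker_mul _ (chart_map K _)) (plucker_mul _ A).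
  apply: eq_bigr => h _; congr (_ * _).
  rewrite -eA; congr (plucker (chart_map K _) _).
  by apply/rowP => i; rewrite !mxE liftK.
Defined.

End Step.

(** [l] is the excess of the sum of entries over its minimum; a positive excess leaves an entry to
    lower, which reduces it by one. *)
Lemma chart_exists l (f : 'I_d -> 'I_n) : injective f ->
  (\sum_j f j = \sum_(k < d) k + l)%N -> inhabited (cell_chart f l).
Proof.
elim: l f => [|l IH] f fI fl.
  by constructor; apply: base_chart => //; rewrite fl addn0.
have [/existsP [k /existsP [r fk]]|nl] :=
  boolP [exists k, exists r, lowerable f k r].
  have [||K] := IH (update f k r).
  - exact: lower_inj fk.
  - by apply: succn_inj; rewrite -lower_sum // fl addnS.
  by constructor; apply: step_chart K.
have nl' k r : ~~ lowerable f k r.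
  by apply: contraNN nl => fk; apply/existsP; exists k; apply/existsP; exists r.
have /eqP := not_lowerable_sum fI nl'.
by rewrite fl -[X in _ == X]addn0 eqn_add2l.
Qed.

End Chart.

Arguments chart_continuous {R n d f l} c.
Arguments chart_rank {R n d f l} c z.
Arguments chart_supp {R n d f l} c z.
Arguments chart_top {R n d f l} c z.
Arguments chart_sqnorm {R n d f l} c z.
Arguments chart_inj {R n d f l} c z z'.
Arguments chart_surj {R n d f l} c B.

(** * From the Euclidean disc to the polydisc *)

Lemma sqnorm_continuous (R : realType) k : continuous (@sqnorm R k).
Proof.
apply: continuous_sum => i _ x.
exact: (cvgM (@coord_continuous _ _ _ 0 i x) (@coord_continuous _ _ _ 0 i x)).
Qed.

Section Disc.
Variables (R : realType) (l : nat).
Local Notation C := R[i].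
Implicit Types (x y : 'rV[R]_(l + l)) (z : 'rV[C]_l).

(** The norm of a complex row is the maximum of the moduli, so its open unit ball is the
    polydisc. *)
Lemma polydiscP z : polydisc z <-> `|z| < 1.
Proof.
have -> : (`|z| < 1) = `[< ball (0 : 'rV[C]_l) 1 z >].
  by rewrite mx_norm_ball /ball_ /= sub0r normrN asboolb.
split=> [zd|/asboolP [_ zd] i]; last first.
  by have := zd 0 i; rewrite -ball_normE /= mxE sub0r normrN.
apply/asboolP; split=> // i j; rewrite ord1 -ball_normE /= mxE sub0r normrN.
exact: zd.
Qed.

Definition complexify x : 'rV[C]_l :=
  \row_i (x 0 (lshift l i) +i* x 0 (rshift l i)).

Definition realify z : 'rV[R]_(l + l) :=
  row_mx (\row_i complex.Re (z 0 i)) (\row_i complex.Im (z 0 i)).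

Lemma realifyK : cancel realify complexify.
Proof.
by move=> z; apply/rowP => i; rewrite mxE row_mxEl row_mxEr !mxE; case: (z 0 i).
Qed.

Lemma complexifyK : cancel complexify realify.
Proof.
move=> x; apply/rowP => i; case: (split_ordP i) => j ->.
  by rewrite row_mxEl !mxE.
by rewrite row_mxEr !mxE.
Qed.

Lemma complexifyZ (c : R) x : complexify (c *: x) = c%:C *: complexify x.
Proof.
by apply/rowP => i; rewrite !mxE; apply/eqP;
  rewrite eq_complex /= !mul0r subr0 addr0 !eqxx.
Qed.

Lemma complexify0 : complexify 0 = 0.
Proof. by rewrite -(scale0r (0 : 'rV[R]_(l + l))) complexifyZ scale0r. Qed.

Lemma complexify_continuous : continuous complexify.
Proof.
have E (z : C) : z = (complex.Re z)%:C + 'i * (complex.Im z)%:C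
  by exact: complexE.
apply: continuous_mx => i j; under eq_fun do rewrite mxE [_ +i* _]E /=.
have cR (k : 'I_(l + l)) : continuous (fun x : 'rV[R]_(l + l) => (x 0 k)%:C :
  C).
  move=> x; exact: (continuous_comp (@coord_continuous _ _ _ 0 k x)
    (@real_complex_continuous _ (x 0 k))).
by move=> x; exact: (cvgD (cR _ x) (cvgM (cvg_cst ('i : C)) (cR _ x))).
Qed.

Definition enorm x : R := Num.sqrt (sqnorm x).

Lemma sqnorm_ge0 x : 0 <= sqnorm x.
Proof. by apply: sumr_ge0 => i _; rewrite sqr_ge0. Qed.

Lemma enorm_ge0 x : 0 <= enorm x. Proof. exact: sqrtr_ge0. Qed.

Lemma enorm_eq0 x : (enorm x == 0) = (x == 0).
Proof.
rewrite sqrtr_eq0 le_eqVlt ltNge sqnorm_ge0 orbF.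
apply/eqP/eqP => [x0|->]; last by apply: big1 => i _; rewrite mxE expr0n.
apply/rowP => i; rewrite mxE; apply/eqP; rewrite -sqrf_eq0.
by apply/eqP/(psumr_eq0P _ x0) => // j _; rewrite sqr_ge0.
Qed.

Lemma enormZ (c : R) x : 0 <= c -> enorm (c *: x) = c * enorm x.
Proof.
move=> c0; rewrite /enorm -[in RHS](ger0_norm c0)
  -sqrtr_sqr -sqrtrM ?sqr_ge0 //.
by congr Num.sqrt; rewrite /sqnorm mulr_sumr; apply: eq_bigr => i _;
  rewrite mxE exprMn.
Qed.

Lemma enorm_continuous : continuous enorm.
Proof.
move=> x; have cs := @sqnorm_continuous R (l + l) x.
exact: (continuous_comp cs (@sqrt_continuous R (sqnorm x))).
Qed.

(** Radial rescaling that turns the Euclidean norm into the maximum norm. At 0 the quotient is 0 by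
    convention and multiplies the zero vector. *)
Definition disc_polydisc x : 'rV[C]_l :=
  ((enorm x)%:C / `|complexify x|) *: complexify x.

Lemma complexify_eq0 x : (complexify x == 0) = (x == 0).
Proof. by rewrite -(inj_eq (can_inj complexifyK)) complexify0. Qed.

Lemma norm_disc_polydisc x : `|disc_polydisc x| = (enorm x)%:C.
Proof.
rewrite normrZ; have [x0|x0] := eqVneq (complexify x) 0.
  rewrite x0 normr0 mulr0; apply/esym/eqP; rewrite -(rmorph0 (real_complex R)).
  by rewrite (inj_eq (@complexI R)) enorm_eq0 -complexify_eq0 x0.
rewrite normrM normfV normr_id mulfVK ?normr_eq0 // ger0_norm //.
by rewrite lecR enorm_ge0.
Qed.

Lemma open_disc_polydisc x : open_disc x <-> polydisc (disc_polydisc x).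
Proof.
rewrite polydiscP norm_disc_polydisc ltcR /open_disc /=.
by rewrite -[X in _ <-> is_true (_ < X)]sqrtr1 /enorm ltr_sqrt.
Qed.

Lemma disc_polydisc_inj : injective disc_polydisc.
Proof.
move=> x y xy; have exy : enorm x = enorm y.
  by apply: (@complexI R); rewrite -!norm_disc_polydisc xy.
have [x0|x0] := eqVneq x 0.
  by apply/esym/eqP; rewrite x0 -enorm_eq0 -exy enorm_eq0 x0.
have y0 : y != 0 by rewrite -enorm_eq0 -exy enorm_eq0.
have pos v : v != 0 -> exists2 c : R, 0 < c & disc_polydisc v =
  complexify (c *: v).
  move=> v0; have n0 : 0 < (enorm v)%:C / `|complexify v|.
    rewrite divr_gt0 // ?normr_gt0 ?complexify_eq0 // ltcR lt_neqAle eq_sym.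
    by rewrite enorm_eq0 v0 enorm_ge0.
  have nE : (enorm v)%:C / `|complexify v| =
    (complex.Re ((enorm v)%:C / `|complexify v|))%:C.
    by rewrite RRe_real // gtr0_real.
  by exists (complex.Re ((enorm v)%:C / `|complexify v|));
    rewrite -?ltcR -?nE // complexifyZ -nE.
have [a a0 ax] := pos x x0; have [b b0 bY] := pos y y0.
have /(can_inj complexifyK) ab : complexify (a *: x) = complexify (b *: y).
  by rewrite -ax -bY.
have := congr1 enorm ab; rewrite !enormZ ?ltW // exy => /mulIf.
rewrite enorm_eq0 => /(_ y0) abE; apply: (scalerI (lt0r_neq0 a0)).
by rewrite ab abE.
Qed.

Lemma disc_polydisc_surj z : exists x, disc_polydisc x = z.
Proof.
have [->|z0] := eqVneq z 0.
  by exists 0; rewrite /disc_polydisc complexify0 scaler0.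
have nz : 0 < `|z| by rewrite normr_gt0.
set w := realify z; have w0 : 0 < enorm w.
  rewrite lt_neqAle enorm_ge0 andbT eq_sym enorm_eq0 -complexify_eq0 realifyK
    //.
have nE : `|z| = (complex.Re `|z|)%:C by rewrite RRe_real.
have r0 : 0 < complex.Re `|z| by rewrite -ltcR -nE.
pose c := complex.Re `|z| / enorm w; have c0 : 0 < c by rewrite divr_gt0.
have cC : 0 < c%:C by rewrite ltcR.
have cE : c * enorm w = complex.Re `|z| by rewrite mulfVK // gt_eqF.
exists (c *: w); rewrite /disc_polydisc complexifyZ realifyK enormZ ?ltW // cE
  -nE.
rewrite normrZ (gtr0_norm cC)
  scalerA [c%:C * _]mulrC invfM mulrA divff ?gt_eqF //.
by rewrite mul1r mulVf ?scale1r // gt_eqF.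
Qed.

Lemma disc_polydisc_continuous : continuous disc_polydisc.
Proof.
have cn : continuous (fun x => `|complexify x| : C).
  by move=> x; exact: (continuous_comp (complexify_continuous (x:=x))
    (@norm_continuous _ _ (complexify x))).
have ce : continuous (fun x => (enorm x)%:C : C).
  by move=> x; exact: (continuous_comp (enorm_continuous (x:=x))
    (@real_complex_continuous _ (enorm x))).
(* At 0 the scaling factor need not have a limit, but the norm of the image is the Euclidean norm,
   which tends to 0. *)
move=> x; have [->|x0] := eqVneq x 0.
  suff : disc_polydisc x @[x --> (0 : 'rV[R]_(l + l))] --> (0 : 'rV[C]_l).
    by rewrite /continuous_at [disc_polydisc 0](_ : _ =
      0) // /disc_polydisc complexify0 scaler0.
  have E : (fun x => `|disc_polydisc x|) = (fun x => (enorm x)%:C).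
    by apply/funext => y; rewrite norm_disc_polydisc.
  have enorm0 : enorm (0 : 'rV[R]_(l + l)) = 0 by apply/eqP; rewrite enorm_eq0.
  have := ce 0; rewrite -E /continuous_at norm_disc_polydisc enorm0.
  exact: (@norm_cvg0 _ _ _ (nbhs (0 : 'rV[R]_(l + l)))).
have nx : `|complexify x| != 0 by rewrite normr_eq0 complexify_eq0.
exact: (cvgZ (cvgM (ce x) (cvgV nx (cn x))) (@complexify_continuous x)).
Qed.

End Disc.

(** * Topology of the orbifold *)

(** Closed subsets of [D] have compact, hence closed, images. The last hypothesis keeps points of
    [D] outside [O] from landing in the image of [O], so the inverse is continuous there. *)
Lemma compact_embedding (X Y : topologicalType) (x0 : X) (D O : set X)
  (f : X -> Y) :
  hausdorff_space Y -> compact D -> O `<=` D -> continuous f ->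
  (forall x y, O x -> O y -> f x = f y -> x = y) ->
  (forall x, D x -> ~ O x -> ~ (f @` O) (f x)) ->
  embedding_on O f.
Proof.
move=> hY cD OD cf fI fO; split; first exact: continuous_subspaceT.
pose g y := xget x0 [set x | O x /\ f x = y].
have gP x : O x -> g (f x) = x.
  move=> Ox; rewrite /g; case: xgetP => [y _ [Oy fy]|/(_ x) nx].
    exact: fI.
  by case: nx.
exists g; split=> //; apply/subspace_continuousP => y [x Ox fxy]; subst y.
move=> U nU; have : nbhs x U by rewrite -(gP _ Ox).
rewrite nbhsE => -[V [oV Vx] VU].
have cK : compact (f @` (D `&` ~` V)).
  apply: continuous_compact; first exact: continuous_subspaceT.
  by apply: compact_closedI => //; exact: open_closedC.
have : nbhs (f x) (~` (f @` (D `&` ~` V))).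
  apply: open_nbhs_nbhs; split.
    by rewrite openC; exact: compact_closed cK.
  move=> [y [Dy nVy] fyx]; have [Oy|nOy] := pselect (O y).
    by apply: nVy; rewrite (fI y x).
  by apply: (fO y Dy nOy); exists x.
apply: filterS => y nK [x' Ox' x'y]; apply: VU.
have gy : g y = x' by rewrite -x'y gP.
change (V (g y)); rewrite gy.
apply: contrapT => nV; apply: nK; exists x' => //; split => //; exact: OD.
Qed.

Section Quotient.
Variables (R : realType) (n d : nat) (w : 'I_n -> nat) (a : nat).
Local Notation C := R[i].
Local Notation FR := (full_rank R n d).
Local Notation X := (WGr R d w a).
Implicit Types (A B : FR) (f : 'I_d -> 'I_n) (t : C).

(** The exponent of [t] on coordinate [f]: [a] comes from the determinant of [T], the sum from the
    diagonal matrix. *)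
Definition weight f : nat := (a + \sum_j w (f j))%N.

Lemma plucker_torus t (A : 'M[C]_(n, d)) f :
  plucker (diag_mx (\row_i t ^+ w i) *m A) f = t ^+ (\sum_j w (f j))
    * plucker A f.
Proof.
by rewrite plucker_diag; congr (_ * _); under eq_bigr do rewrite mxE;
  rewrite prodrXr.
Qed.

Lemma diag_row_free t (A : FR) : t != 0 ->
  \rank (diag_mx (\row_i t ^+ w i) *m sval A) = d.
Proof.
move=> t0; rewrite eqmxMfull; first exact: (set_valP A).
rewrite row_full_unit unitmxE det_diag unitfE; apply/prodf_neq0 => i _.
by rewrite mxE expf_neq0.
Qed.

Lemma wsimP A B : wsim w a A B <->
  exists2 t, t != 0 & forall f, plucker (sval B) f =
    t ^+ weight f * plucker (sval A) f.
Proof.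
split=> [[T [t [uT t0 tT ->]]]|[t t0 e]].
  by exists t => // f; rewrite plucker_mulr plucker_torus -tT /weight exprD
    mulrC mulrA.
have [|||T [uT tT eB]] :=
  @plucker_eq_scale _ _ _ (diag_mx (\row_i t ^+ w i) *m sval A)
  (sval B) (t ^+ a).
- exact: diag_row_free.
- exact: expf_neq0.
- by move=> f; rewrite e plucker_torus /weight exprD mulrA.
by exists T, t.
Qed.

Lemma pi_wsimP A B : \pi_X A = \pi_X B <-> wsim w a A B.
Proof.
split=> [e|e].
  by have /eqmodP/asboolP :=
    (e : \pi_({eq_quot (wsim_rel R d w a)}) A =
    \pi_({eq_quot (wsim_rel R d w a)}) B).
suff : \pi_({eq_quot (wsim_rel R d w a)}) A =
  \pi_({eq_quot (wsim_rel R d w a)}) B by [].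
exact/eqmodP/asboolP.
Qed.

Lemma full_rank_continuous (T : topologicalType) (f : T -> FR) :
  continuous (fun x => sval (f x)) -> continuous f.
Proof.
move=> cf; apply/continuousP => A [B oB <-].
by rewrite -comp_preimage; move/continuousP: cf; apply.
Qed.

Lemma sval_full_rank_continuous : continuous (fun A : FR => sval A).
Proof. exact: initial_continuous. Qed.

(** The projection is open: the saturation of an open set is a union of preimages under the
    continuous maps [g] that implement the equivalence. *)
Lemma pi_nbhs A (U : set FR) : nbhs A U -> nbhs (\pi_X A : X) (\pi_X @` U).
Proof.
rewrite nbhsE => -[V [oV VA] VU].
apply: (@filterS _ _ _ (\pi_X @` V : set X)).
  by move=> _ [B VB <-]; exists B => //; exact: VU.
apply: open_nbhs_nbhs; split; last by exists A.
rewrite /open /= /quotient_open openE => B [B' VB' /pi_wsimP /wsim_sym].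
move=> [T [t [uT t0 tT eB]]].
have rk (D : FR) : [set D : 'M[C]_(n, d) | \rank D =
  d] (diag_mx (\row_i t ^+ w i) *m sval D *m T).
  by rewrite /= mxrankMfree ?row_free_unit // diag_row_free.
pose g (D : FR) : FR :=
  exist (fun M => M \in [set D : 'M[C]_(n, d) | \rank D = d])
    _ (mem_set (rk D)).
have gB : g B = B' by apply: val_inj; rewrite /= eB.
have cg : continuous g.
  apply: full_rank_continuous; apply: continuous_mulmx.
    by apply: continuous_mulmx;
      [exact: cst_continuous|exact: sval_full_rank_continuous].
  exact: cst_continuous.
have : nbhs B (g @^-1` V) by apply: cg; rewrite gB; exact: open_nbhs_nbhs.
apply: filterS => D VgD; exists (g D) => //; apply/pi_wsimP/wsim_sym.
by exists T, t.
Qed.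

Hypothesis a0 : (0 < a)%N.

Lemma weight_gt0 f : (0 < weight f)%N. Proof. by rewrite ltn_addr. Qed.

(* The scalars [t] relating points near [A] to points near [B] stay bounded, so
   by compactness some limit value relates [A] to [B]; it is nonzero because
   [B] has a nonzero coordinate of positive weight. *)
Lemma WGr_hausdorff : hausdorff_space X.
Proof.
move=> p q; rewrite -(reprK p) -(reprK q).
move: (repr p) (repr q) => A B {p q} clAB; apply/pi_wsimP.
have [f0 A0] := @rank_plucker _ _ _ (sval A) (set_valP A).
have [f1 B1] := @rank_plucker _ _ _ (sval B) (set_valP B).
have clU (U : set (FR * FR)) : nbhs (A, B) U ->
    exists AB, U AB /\ wsim w a AB.1 AB.2.
  move=> [[/= U1 U2] [/pi_nbhs nA /pi_nbhs nB] UU].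
  have [_ [[A' UA' <-] [B' UB' /esym/pi_wsimP AB']]] := clAB _ _ nA nB.
  by exists (A', B'); split => //; exact: UU.
have cA : continuous (fun AB : FR * FR => sval AB.1).
  move=> AB; exact: (continuous_comp (@cvg_fst _ _ (nbhs AB.1) (nbhs AB.2) _)
    (@sval_full_rank_continuous AB.1)).
have cB : continuous (fun AB : FR * FR => sval AB.2).
  move=> AB; exact: (continuous_comp (@cvg_snd _ _ (nbhs AB.1) (nbhs AB.2) _)
    (@sval_full_rank_continuous AB.2)).
have cplA f := @continuous_plucker _ _ _ _ _ f cA.
have cplB f := @continuous_plucker _ _ _ _ _ f cB.
pose nr (z : C) : R := complex.Re `|z|.
have nrE z : (nr z)%:C = `|z| by rewrite RRe_real.
have nr0 z : 0 <= nr z by rewrite -lecR nrE (normr_ge0 z).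
have cnr : continuous nr.
  move=> z; exact: (continuous_comp (@norm_continuous C C^o z)
    (@Re_continuous R `|z|)).
have nrA : 0 < nr (plucker (sval A) f0).
  by rewrite -ltcR nrE; rewrite -normr_gt0 in A0.
(* Chosen so that at [(A, B)], hence nearby, coordinate [f0] of the second matrix has modulus less
   than [k] times that of the first; the summand 1 makes this strict. *)
pose k := (nr (plucker (sval B) f0) + 1) / nr (plucker (sval A) f0).
have bound : nbhs (A, B) [set AB : FR * FR |
    0 < k * nr (plucker (sval AB.1) f0) - nr (plucker (sval AB.2) f0)].
  have c1 := continuous_comp (cplA f0 (A, B)) (cnr (plucker (sval A) f0)).
  have c2 := continuous_comp (cplB f0 (A, B)) (cnr (plucker (sval B) f0)).
  apply: (cvgr_gt _ (cvgB (cvgM (cvg_cst k) c1) c2)) => /=.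
  by rewrite mulfVK ?gt_eqF // addrAC subrr add0r.
(* The scalar [t] is encoded by its real and imaginary parts, so that its range [K] is a real
   box. *)
pose coord (v : 'rV[R]_(1 + 1)) : C := complexify v 0 0.
have ccoord : continuous coord.
  by apply: continuous_entry; exact: complexify_continuous.
pose K := [set v : 'rV[R]_(1 + 1) | forall i,
  `[- (1 + k), 1 + k]%classic (v ord0 i)].
have cK : compact K.
  by apply: (@rV_compact _ _ (fun=> `[- (1 + k), 1 + k]%classic)) => i;
    exact: segment_compact.
pose P (AB : FR * FR) v := ~ forall f, plucker (sval AB.2) f =
  coord v ^+ weight f * plucker (sval AB.1) f.
apply: contrapT => nAB.
(* If no scalar relates [A] to [B], each candidate fails at some coordinate, which is an open
   condition; compactness of [K] makes it uniform. *)
have nearP v : K v -> \forall v' \near v & AB \near nbhs (A, B), P AB v'.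
  move=> _.
  have [f nf] : exists f, plucker (sval B)
    f - coord v ^+ weight f * plucker (sval A) f != 0.
    apply: contrapT => /forallNP e; apply: nAB; apply/wsimP.
    have {}e f : plucker (sval B) f = coord v ^+ weight f * plucker (sval A) f.
      by apply/eqP; rewrite -subr_eq0; apply/negPn/negP; exact: e.
    exists (coord v) => //; apply: contra_neq B1 => t0.
    by rewrite e t0 expr0n gtn_eqF ?weight_gt0 // mul0r.
  pose phi (z : 'rV[R]_(1 + 1) * (FR * FR)) : C :=
    plucker (sval z.2.2) f - coord z.1 ^+ weight f * plucker (sval z.2.1) f.
  have cphi : {for (v, (A, B)), continuous phi}.
    have c1 : (fun z : 'rV[R]_(1 + 1) * (FR * FR) => plucker (sval z.2.2) f)
      z @[z --> (v, (A, B))] -->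
        plucker (sval B) f.
      exact: (cvg_comp _ _ (@cvg_snd _ _ (nbhs v) (nbhs (A, B)) _)
        (cplB f (A, B))).
    have c2 : (fun z : 'rV[R]_(1 + 1) * (FR * FR) => plucker (sval z.2.1) f)
      z @[z --> (v, (A, B))] -->
        plucker (sval A) f.
      exact: (cvg_comp _ _ (@cvg_snd _ _ (nbhs v) (nbhs (A, B)) _)
        (cplA f (A, B))).
    have c3 : (fun z : 'rV[R]_(1 + 1) * (FR * FR) => coord z.1)
      z @[z --> (v, (A, B))] --> coord v.
      exact: (cvg_comp _ _ (@cvg_fst _ _ (nbhs v) (nbhs (A, B)) _) (ccoord v)).
    have c4 m : (fun z : 'rV[R]_(1 + 1) * (FR * FR) => coord z.1 ^+ m)
      z @[z --> (v, (A, B))] --> coord v ^+ m.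
      elim: m => [|m IH]; first exact: (cvg_cst (1 : C)).
      under eq_fun do rewrite exprS.
      by rewrite exprS; exact: (cvgM c3 IH).
    exact: (cvgB c1 (cvgM (c4 _) c2)).
  have : nbhs (v, (A, B)) [set z | phi z != 0].
    have : nbhs (phi (v, (A, B))) [set z : C | z != 0].
      apply/nbhs_ballP; exists `|phi (v, (A, B))|; first
        by rewrite /= normr_gt0.
      move=> z; rewrite -ball_normE /=; apply: contraTneq => ->.
      by rewrite subr0 ltxx.
    exact: cphi.
  apply: filterS => -[v' AB] /=; rewrite /phi /= subr_eq0 => /eqP ne e.
  by apply: ne; exact: e.
have /compact_near_coveringP/(_ _ (nbhs (A, B)) P _ nearP) KP := cK.
have [[A' B'] [[/= KP' bd] /wsimP [t t0 e]]] := clU _ (filterI KP bound).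
have tE : coord (realify (const_mx t)) = t by rewrite /coord realifyK mxE.
apply: (KP' (realify (const_mx t))); last by move=> f; rewrite tE; exact: e.
have nt : nr t <= 1 + k.
  have k0 : 0 < k by apply: divr_gt0 nrA; exact: ltr_wpDl (nr0 _) ltr01.
  have [t1|t1] := leP (nr t) 1; first by rewrite (le_trans t1) // lerDl ltW.
  have A'0 : 0 < nr (plucker (sval A') f0).
    rewrite lt_neqAle nr0 andbT eq_sym; apply: contraTneq bd => E.
    by rewrite E mulr0 sub0r oppr_gt0 -leNgt nr0.
  have tk : nr t ^+ weight f0 < k.
    rewrite -(ltr_pM2r A'0) -subr_gt0 (lt_le_trans bd) // lerD2l lerN2.
    rewrite -lecR rmorphM rmorphXn !nrE (e f0) normrM normrX //.
  rewrite (le_trans (ler_eXnr (weight_gt0 f0)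
    (ltW t1))) // (le_trans (ltW tk)) //.
  by rewrite lerDr.
have reim (x : R) : `|x|%:C <= `|t| -> `[- (1 + k), 1 + k]%classic x.
  rewrite -nrE lecR => xt; rewrite /= in_itv /= -ler_norml; exact: le_trans nt.
move=> i; case: (split_ordP i) => j ->.
  by rewrite row_mxEl !mxE; apply: reim; exact: normc_ge_Re.
rewrite row_mxEr !mxE; apply: reim; rewrite normc_def lecR -sqrtr_sqr.
by rewrite ler_wsqrtr // lerDr sqr_ge0.
Qed.

End Quotient.

(** * Weighted scalings *)

(** Either no modulus grows or none shrinks, so equal sums leave every term unchanged; a nonzero
    term then gives [|t| = 1]. *)
Lemma weighted_norm1 (C : numFieldType) (I : finType) (c : I -> nat)
  (p q : I -> C) t :
  (forall i, (0 < c i)%N) -> (forall i, q i = t ^+ c i * p i) ->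
  \sum_i `|q i| ^+ 2 = \sum_i `|p i| ^+ 2 -> (exists i, p i != 0) -> `|t| = 1.
Proof.
move=> c0 qE qp [i pi0].
have qnE j : `|q j| ^+ 2 = (`|t| ^+ c j) ^+ 2 * `|p j| ^+ 2.
  by rewrite qE normrM normrX exprMn.
have p2 j : 0 <= `|p j| ^+ 2 by rewrite exprn_ge0.
have tj j : 0 <= `|t| ^+ c j by rewrite exprn_ge0.
have eq_i : `|q i| ^+ 2 = `|p i| ^+ 2.
  have [t1|/ltW t1] := real_leP (normr_real t) (real1 C).
    apply/esym/eqP; rewrite -subr_eq0; apply/eqP.
    apply: (@psumr_eq0P _ _ xpredT (fun j =>
      `|p j| ^+ 2 - `|q j| ^+ 2)) => // [j _|].
      rewrite qnE -{1}[_ ^+ 2]mul1r -mulrBl mulr_ge0 // subr_ge0.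
      by rewrite !exprn_ile1 ?exprn_ge0.
    by rewrite sumrB qp subrr.
  apply/eqP; rewrite -subr_eq0; apply/eqP.
  apply: (@psumr_eq0P _ _ xpredT (fun j =>
    `|q j| ^+ 2 - `|p j| ^+ 2)) => // [j _|].
    rewrite qnE -{2}[`|p j| ^+ 2]mul1r -mulrBl mulr_ge0 // subr_ge0.
    by rewrite !exprn_ege1.
  by rewrite sumrB qp subrr.
have pn0 : `|p i| ^+ 2 != 0 by rewrite expf_neq0 // normr_eq0.
move: eq_i; rewrite qnE -[RHS]mul1r => /(mulIf pn0)/eqP.
by rewrite -exprM pexpr_eq1 ?muln_gt0 ?c0 // => /eqP.
Qed.

(** The modulus of [t] comes from the intermediate value theorem for a real polynomial, its phase
    from a root of order [c i0]. *)
Lemma weighted_scaling (R : realType) (I : finType) (c : I -> nat)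
  (p : I -> R[i]) (i0 : I) (N : R[i]) :
  (forall i, (0 < c i)%N) -> p i0 != 0 -> 0 < N ->
  exists t : R[i], [/\ t != 0, 0 < t ^+ c i0 * p i0 &
    \sum_i `|t ^+ c i * p i| ^+ 2 = N].
Proof.
move=> c0 p0 N0.
pose m i : R := complex.Re (`|p i| ^+ 2).
have mE i : (m i)%:C = `|p i| ^+ 2 by rewrite RRe_real // realX.
have NE : (complex.Re N)%:C = N by rewrite RRe_real // gtr0_real.
have m0 i : 0 <= m i by rewrite -lecR mE exprn_ge0.
have mi0 : 0 < m i0 by rewrite -ltcR mE exprn_gt0 // normr_gt0.
have N0' : 0 < complex.Re N by rewrite -ltcR NE.
pose P : {poly R} := \sum_i m i *: 'X^(c i * 2) - (complex.Re N)%:P.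
have PE x : P.[x] = \sum_i m i * x ^+ (c i * 2) - complex.Re N.
  rewrite hornerD hornerN hornerC horner_sum; congr (_ - _).
  by apply: eq_bigr => i _; rewrite hornerZ hornerXn.
(* As [b >= 1], the term of [i0] alone is at least [m i0 * b], which exceeds the target by
   [m i0]. *)
pose b := 1 + complex.Re N / m i0.
have b1 : 1 <= b by rewrite lerDl divr_ge0 // ltW.
have b0 : 0 <= b by exact: le_trans b1.
have [||x /andP [x0 _] /eqP Px] := @poly_ivt _ P 0 b.
- exact: b0.
- apply/andP; split.
    rewrite PE big1 ?sub0r ?oppr_le0 ?ltW // => i _.
    by rewrite expr0n muln_eq0 (gtn_eqF (c0 i)) mulr0.
  rewrite PE subr_ge0 (bigD1 i0) //= -[leLHS]addr0 lerD //; last first.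
    by apply: sumr_ge0 => i _; rewrite mulr_ge0 // exprn_ge0.
  have bb : b <= b ^+ (c i0 * 2) by rewrite ler_eXnr ?muln_gt0 ?c0.
  rewrite (le_trans _ (ler_wpM2l (m0 i0)
    bb)) // mulrDr mulr1 mulrC mulfVK ?gt_eqF //.
  by rewrite lerDr.
have {}Px : \sum_i m i * x ^+ (c i * 2) = complex.Re N.
  by apply/eqP; rewrite -subr_eq0 -PE Px.
have xn0 : x != 0.
  apply: contraTneq N0' => x00; rewrite -Px x00 big1 ?ltxx // => i _.
  by rewrite expr0n muln_eq0 (gtn_eqF (c0 i)) mulr0.
have xgt0 : 0 < x%:C by rewrite ltcR lt_neqAle eq_sym xn0.
pose u := (c i0).-root (`|p i0| / p i0).
have uc : u ^+ c i0 = `|p i0| / p i0 by rewrite rootCK.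
have u1 : `|u| = 1.
  apply/eqP; rewrite -(@pexpr_eq1 _ _ (c i0)) ?c0 // -normrX uc.
  by rewrite normrM normfV normr_id divff ?normr_eq0.
have un0 : u != 0 by rewrite -normr_eq0 u1 oner_eq0.
exists (x%:C * u); split.
- by rewrite mulf_neq0 // gt_eqF.
- by rewrite exprMn uc -mulrA mulfVK // mulr_gt0 ?exprn_gt0 ?normr_gt0.
- rewrite -NE -Px rmorph_sum; apply: eq_bigr => i _.
  rewrite normrM normrX normrM u1 mulr1 (gtr0_norm xgt0) exprMn -exprM.
  by rewrite rmorphM rmorphXn /= mE mulrC.
Qed.

(** * Schubert cells *)

Section DiscCompact.
Variables (R : realType) (k : nat).

Lemma closed_disc_compact : compact (@closed_disc R k).
Proof.
apply: (@subclosed_compact _ _ [set v : 'rV[R]_k |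
  forall i, `[- 1, 1 : R]%classic (v ord0 i)]).
- have -> : @closed_disc R k = @sqnorm R k @^-1` [set y | y <= 1] by [].
  apply: preimage_closed; last exact: closed_le.
  by move=> x _; exact: sqnorm_continuous.
- by apply: (@rV_compact R k (fun=> `[- 1, 1]%classic)) => i;
  exact: segment_compact.
- move=> v vd i; rewrite /= in_itv /= -ler_norml -(@expr_le1 _ 2) //.
  rewrite real_normK ?num_real //; apply: le_trans vd.
  rewrite /sqnorm (bigD1 i) //= lerDl.
  by apply: sumr_ge0 => j _; rewrite sqr_ge0.
Qed.

End DiscCompact.

Section RowSub.
Variables (F : fieldType) (n d : nat).

Lemma plucker_rowsub (s : 'I_n -> 'I_n) (A : 'M[F]_(n, d)) (f : 'I_d -> 'I_n) :
  plucker (rowsub s A) f = plucker A (s \o f).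
Proof. by congr (\det _); apply/matrixP => i j; rewrite !mxE. Qed.

Lemma rank_rowsub (s : 'S_n) (A : 'M[F]_(n, d)) : \rank A = d ->
  \rank (rowsub s A) = d.
Proof.
move=> /rank_plucker [f nz]; apply: (@plucker_rank _ _ _ _ (s^-1%g \o f)).
by rewrite plucker_rowsub (@eq_plucker _ _ _ _ _ f) // => j /=; rewrite permKV.
Qed.

End RowSub.

Section Cells.
Variables (R : realType) (n d : nat) (w : 'I_n -> nat) (a : nat).
Variables (lam : 'I_('C(n, d)) -> schubert n d) (s : 'S_n).
Hypotheses (d_gt0 : (0 < d)%N) (a_gt0 : (0 < a)%N).
Hypothesis lamO : schubert_order lam.
Hypothesis div_s : forall i j : 'I_('C(n, d)),
  nat_of_ord j = i.+1 -> (sigma_c w a lam s j %| sigma_c w a lam s i)%N.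
Local Notation C := R[i].
Local Notation FR := (full_rank R n d).
Local Notation X := (WGr R d w a).
Local Notation N := ('C(n, d)).
Implicit Types (A B : FR) (f g : 'I_d -> 'I_n) (i j : 'I_N) (t : C).

Definition symbol i : {ffun 'I_d -> 'I_n} := sval (lam i).

Lemma symbol_increasing i : increasing (symbol i).
Proof.
by move=> k l kl; have /forallP/(_ k)/forallP/(_ l)/implyP := svalP (lam i);
  apply.
Qed.

Lemma symbol_inj i : injective (symbol i).
Proof. exact/increasing_inj/symbol_increasing. Qed.

Lemma symbol_sort g : injective g -> exists i (p : 'S_d), symbol i =1 g \o p.
Proof.
move=> /injective_sort [p pI].
have pT : [forall i : 'I_d, forall j : 'I_d, (i < j)%N ==>
    ([ffun k => g (p k)] i < [ffun k => g (p k)] j)%N].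
  by apply/forallP => k; apply/forallP => l; apply/implyP => kl;
    rewrite !ffunE; exact: pI.
pose m : schubert n d := exist (fun l : {ffun 'I_d -> 'I_n} =>
  is_true [forall i : 'I_d, forall j : 'I_d, (i < j)%N ==> (l i < l j)%N]) _ pT.
have [[lam' lamK lam'K] _] := lamO.
by exists (lam' m), p => k; rewrite /symbol lam'K ffunE.
Qed.

Lemma below_symbol i j : below (symbol i) (symbol j) -> (i <= j)%N.
Proof.
by move=> ij; apply: lamO.2 => k; apply: increasing_below;
  try exact: symbol_increasing.
Qed.

Lemma below_symbol_anti i j : below (symbol i) (symbol j) -> below (symbol j)
  (symbol i) -> i = j.
Proof.
by move=> /below_symbol ij /below_symbol ji; apply: val_inj; apply/eqP;
  rewrite eqn_leq ij.
Qed.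

Definition cell_weight f : nat := weight w a (s \o f).

Lemma cell_weight_symbol i : cell_weight (symbol i) = sigma_c w a lam s i.
Proof. by []. Qed.

Lemma cell_weight_perm f (p : 'S_d) : cell_weight (f \o p) = cell_weight f.
Proof. by congr (a + _)%N; rewrite [RHS](reindex_inj (@perm_inj _ p)). Qed.

Lemma cell_weight_gt0 f : (0 < cell_weight f)%N. Proof. exact: weight_gt0. Qed.

Lemma eq_cell_weight f g : f =1 g -> cell_weight f = cell_weight g.
Proof. by move=> fg; congr (a + _)%N; apply: eq_bigr => k _ /=; rewrite fg. Qed.

Lemma dvdn_sigma_c i j : (i <= j)%N ->
  (sigma_c w a lam s j %| sigma_c w a lam s i)%N.
Proof.
case: j => j; elim: j => [|j IH] jN /= ij.
  by rewrite (_ : i = Ordinal jN) //; apply: val_inj; apply/eqP; rewrite -leqn0.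
move: ij; rewrite leq_eqVlt => /predU1P [e|ij].
  by rewrite (_ : i = Ordinal jN) //; exact: val_inj.
apply: dvdn_trans (IH (ltnW jN) ij).
exact: (@div_s (Ordinal (ltnW jN)) (Ordinal jN)).
Qed.

(** Sorting [g] gives a symbol of the same weight below symbol [i]; it comes no later in the total
    order, so the chain of divisibilities applies. *)
Lemma dvdn_cell_weight i g : injective g ->
  below g (symbol i) -> (cell_weight (symbol i) %| cell_weight g)%N.
Proof.
move=> gI gi; have [j [p jg]] := symbol_sort gI.
rewrite -(cell_weight_perm g p) -(eq_cell_weight jg) !cell_weight_symbol;
  apply/dvdn_sigma_c/below_symbol => x.
have -> : count_ge x (symbol j) = count_ge x (g \o p).
  by apply: eq_bigr => k _; rewrite jg.
by rewrite count_ge_perm.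
Qed.

(** The complex dimension, which is the number of lowering steps. The subtraction is exact because
    an injective tuple has at least the minimal sum. *)
Definition cell_dim i : nat := (\sum_k symbol i k - \sum_(k < d) k)%N.

Lemma symbol_sum i : (\sum_k symbol i k = \sum_(k < d) k + cell_dim i)%N.
Proof. by rewrite subnKC // injective_sum //; exact: symbol_inj. Qed.

Lemma cell_dim_lt i j : below (symbol j) (symbol i) -> j != i ->
  (cell_dim j < cell_dim i)%N.
Proof.
move=> ji ne; have : (\sum_k symbol j k < \sum_k symbol i k)%N.
  rewrite ltnNge; apply: contra ne => sij; apply/eqP/below_symbol_anti => // x.
  by rewrite (below_sum_ge ji sij).
by rewrite !symbol_sum ltn_add2l.
Qed.

Lemma symbol_chart_exists i : exists K : cell_chart R (symbol i) (cell_dim i),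
  True.
Proof. by have [K] := chart_exists R (@symbol_inj i) (symbol_sum i);
  exists K. Qed.

Definition symbol_chart i : cell_chart R (symbol i) (cell_dim i) :=
  projT1 (cid (symbol_chart_exists i)).

Lemma char_rank i z : \rank (rowsub s^-1%g (chart_map (symbol_chart i) z)) = d.
Proof. by apply: rank_rowsub; exact: chart_rank. Qed.

(** Permuting the rows by the inverse of [s] makes the chart coordinate [g] the coordinate [s \o g]
    of the result. *)
Definition char_fr i (z : 'rV[C]_(cell_dim i)) : FR :=
  exist (fun M => M \in [set D : 'M[C]_(n, d) | \rank D = d]) _
    (mem_set (char_rank z)).

Definition char_map i (x : 'rV[R]_(cell_dim i + cell_dim i)) : X :=
  \pi_X (char_fr (disc_polydisc x)).

Lemma plucker_char_fr i z g :
  plucker (sval (@char_fr i z))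
    (s \o g) = plucker (chart_map (symbol_chart i) z) g.
Proof. by rewrite plucker_rowsub; apply: eq_plucker => k /=; rewrite permK. Qed.

Lemma char_map_continuous i : continuous (@char_map i).
Proof.
have cM : continuous (fun x =>
  sval (char_fr (@disc_polydisc R (cell_dim i) x))).
  apply: continuous_mx => k l; under eq_fun do rewrite mxE.
  have cK := chart_continuous (symbol_chart i).
  move=> x; have cx := continuous_comp (@disc_polydisc_continuous R _ x)
    (cK (disc_polydisc x)).
  exact: (continuous_comp cx (@coord_continuous _ _ _ _ _ _)).
have cF := full_rank_continuous cM.
by move=> x; exact: (continuous_comp (cF x) (@pi_continuous _ _ _)).
Qed.

Definition in_cell i A :=
  plucker (sval A) (s \o symbol i) != 0 /\ supp_below (rowsub s (sval A))
    (symbol i).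

Lemma in_cell_scale i A B (c : ('I_d -> 'I_n) -> C) :
  (forall f, c f != 0) -> (forall f, plucker (sval B) f =
    c f * plucker (sval A) f) ->
  in_cell i A -> in_cell i B.
Proof.
move=> c0 e [Ai sA]; split; first by rewrite e mulf_neq0.
move=> g; rewrite plucker_rowsub e mulf_eq0 (negPf (c0 _)) /= -plucker_rowsub;
  exact: sA.
Qed.

Lemma in_cell_pi i A B : \pi_X A = \pi_X B -> in_cell i A -> in_cell i B.
Proof.
move=> /pi_wsimP/wsimP [t t0]; apply: in_cell_scale => f; exact: expf_neq0.
Qed.

(** Each coordinate is multiplied by a nonzero product of torus entries, so the vanishing pattern is
    preserved. *)
Lemma in_cell_torus i A (t : torus R n) : in_cell i A ->
  in_cell i (torus_mul t A).
Proof.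
apply: (in_cell_scale (c := fun f => \prod_k sval t 0 (f k))) => f.
  by apply/prodf_neq0 => k _; exact: (set_valP t).
exact: plucker_diag.
Qed.

Lemma in_cell_exists A : exists i, in_cell i A.
Proof.
have [g [nz gmax]] := echelon (rank_rowsub s (set_valP A)).
have [i [p ig]] := symbol_sort (plucker_inj nz); exists i; split.
  rewrite -plucker_rowsub (eq_plucker _ ig)
    plucker_perm mulf_neq0 // signr_eq0 //.
move=> h /gmax hg x; have -> : count_ge x (symbol i) = count_ge x (g \o p).
  by apply: eq_bigr => k _; rewrite ig.
by rewrite count_ge_perm.
Qed.

Lemma in_cell_uniq i j A : in_cell i A -> in_cell j A -> i = j.
Proof.
rewrite /in_cell -!plucker_rowsub => -[Ai sAi] [Aj sAj].
exact: below_symbol_anti (sAj _ Ai) (sAi _ Aj).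
Qed.

Lemma char_fr_in_cell i z : polydisc z -> in_cell i (@char_fr i z).
Proof.
move=> zd; split.
  by rewrite plucker_char_fr chart_top; apply/prodf_neq0 => k _;
    rewrite gt_eqF // rotsin_gt0.
by move=> g; rewrite plucker_rowsub plucker_char_fr; exact: chart_supp.
Qed.

Lemma char_map_surj i A : in_cell i A -> exists2 x, open_disc x &
  @char_map i x = \pi_X A.
Proof.
move=> [Ai sA]; set K := symbol_chart i.
have N0 : 0 < chart_norm K.
  rewrite -(chart_sqnorm K 0) => [|k]; last by rewrite mxE normr0 ltr01.
  by rewrite plucker_sqnorm_gt0 // chart_rank.
have [t [t0 ti tN]] := @weighted_scaling R _ (fun g :
  {ffun 'I_d -> 'I_n} => cell_weight g)
  (fun g : {ffun 'I_d -> 'I_n} => plucker (sval A) (s \o g)) (symbol i) _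
  (fun g : {ffun 'I_d -> 'I_n} => cell_weight_gt0 g) Ai N0.
(* Any matrix of determinant [t ^ a] would do; the factor sits in one diagonal entry, available
   because [0 < d]. *)
pose T : 'M[C]_d := diag_mx (\row_k if k == Ordinal d_gt0 then t ^+ a else 1).
have dT : \det T = t ^+ a.
  rewrite det_diag (bigD1 (Ordinal d_gt0)) //= mxE eqxx big1 ?mulr1 // => k kn.
  by rewrite mxE (negPf kn).
pose B := rowsub s (diag_mx (\row_k t ^+ w k) *m sval A *m T).
have plB g : plucker B g = t ^+ cell_weight g * plucker (sval A) (s \o g).
  by rewrite plucker_rowsub plucker_mulr plucker_torus dT mulrAC -exprD addnC.
have Bi : 0 < plucker B (symbol i) by rewrite plB.
have rB : \rank B = d by apply: (@plucker_rank _ _ _ _ (symbol i));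
  rewrite gt_eqF.
have [||z zd e] := chart_surj K B rB _ Bi.
- move=> g; rewrite plB mulf_eq0 expf_eq0 (negPf t0) andbF /= -plucker_rowsub;
  exact: sA.
- by rewrite -tN /plucker_sqnorm; apply: eq_bigr => g _; rewrite plB.
have [x xz] := disc_polydisc_surj z; exists x.
  by apply/open_disc_polydisc; rewrite xz.
apply/pi_wsimP/wsim_sym/wsimP; exists t => // f; rewrite xz.
have fE : f =1 s \o (s^-1%g \o f) by move=> k /=; rewrite permKV.
have wE : cell_weight (s^-1%g \o f) = weight w a f.
  by congr (a + _)%N; apply: eq_bigr => k _; rewrite -fE.
by rewrite (eq_plucker _ fE) (eq_plucker (sval A) fE) plucker_char_fr e plB wE.
Qed.

Lemma char_map_image i : @char_map i @` @open_disc R _ =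
  [set \pi_X A | A in in_cell i].
Proof.
apply/seteqP; split=> [_ [x /open_disc_polydisc xd <-]|_ [A Ai <-]].
  by exists (char_fr (disc_polydisc x)) => //; exact: char_fr_in_cell.
by have [x xd xA] := char_map_surj Ai; exists x.
Qed.

Lemma char_map_inj i x y : open_disc x -> open_disc y ->
  @char_map i x = @char_map i y -> x = y.
Proof.
move=> /open_disc_polydisc xd /open_disc_polydisc yd /pi_wsimP/wsimP [t t0 e].
apply: (@disc_polydisc_inj R (cell_dim i)).
apply: (chart_inj (symbol_chart i) _ _ xd yd) => g.
set p := plucker (chart_map _ (disc_polydisc x)); set q :=
  plucker (chart_map _ (disc_polydisc y)).
have {}e h : q h = t ^+ cell_weight h * p h
  by rewrite /q /p -!plucker_char_fr e.
have p0 : 0 < p (symbol i) by rewrite /p chart_top prodr_gt0 // => k _;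
  rewrite rotsin_gt0.
have q0 : 0 < q (symbol i) by rewrite /q chart_top prodr_gt0 // => k _;
  rewrite rotsin_gt0.
have pq : plucker_sqnorm (chart_map (symbol_chart i) (disc_polydisc y)) =
    plucker_sqnorm (chart_map (symbol_chart i) (disc_polydisc x)).
  by rewrite (chart_sqnorm _ _ xd) (chart_sqnorm _ _ yd).
have t1 : `|t| = 1.
  have ex : exists h : {ffun 'I_d -> 'I_n}, p h != 0.
    by exists (symbol i); exact: (lt0r_neq0 p0).
  exact: (@weighted_norm1 C {ffun 'I_d -> 'I_n} (fun h => cell_weight h)
    (fun h => p h)
    (fun h => q h) t (fun h => cell_weight_gt0 h) (fun h => e h) pq ex).
have ti : t ^+ cell_weight (symbol i) = 1.
  have : 0 < t ^+ cell_weight (symbol i) by rewrite -(pmulr_lgt0 _ p0) -e.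
  by move=> /gtr0_norm <-; rewrite normrX t1 expr1n.
rewrite e; have [->|ph] := eqVneq (p g) 0; first by rewrite mulr0.
(* A nonzero coordinate has an injective index tuple below symbol [i], so [t] acts on it by a power
   of [t ^ cell_weight (symbol i)]. *)
have /dvdnP [m ->] := dvdn_cell_weight (plucker_inj ph) (chart_supp _ _ _ ph).
rewrite mulnC exprM ti expr1n; exact/esym/mul1r.
Qed.

(** The image lies in the cell of a symbol below symbol [i]. If it were [i] itself, the product of
    the [rotsin] values would be nonzero and the point interior. *)
Lemma char_map_sphere i x : closed_disc x -> ~ open_disc x ->
  exists2 j, (cell_dim j < cell_dim i)%N & (@char_map j @` @open_disc R _)
    (@char_map i x).
Proof.
move=> xd nxd; have [j Aj] := in_cell_exists (char_fr (disc_polydisc x)).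
exists j; last by rewrite char_map_image; exists (char_fr (disc_polydisc x)).
have [nz _] := Aj; rewrite plucker_char_fr in nz.
have ji := chart_supp _ _ _ nz; apply: cell_dim_lt => //.
apply: contra_notN nxd => /eqP ij; apply/open_disc_polydisc => k.
rewrite -rotsin_gt0 lt_neqAle rotsin_ge0 andbT eq_sym.
by move: nz; rewrite ij chart_top => /prodf_neq0; apply.
Qed.

End Cells.

(** * Assembly of the invariant cell structure *)

Theorem theoremB (R : realType) (n d : nat) (w : 'I_n -> nat) (a : nat)
    (lam : 'I_('C(n, d)) -> schubert n d) :
  (1 <= d)%N -> (d < n)%N -> (1 <= a)%N ->
  schubert_order lam ->
  divisive w a lam ->
  exists K : cw_structure R (WGr R d w a),
    (forall (i : cw_index K) (t : torus R n),
        torus_act t @` open_cell i `<=` open_cell i) /\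
    (forall i : cw_index K, ~~ odd (cw_dim K i)).
Proof.
move=> d0 _ a0 lamO [s div_s].
(* The real dimension is twice the number of complex parameters, hence even. *)
pose dimf i := (cell_dim lam i + cell_dim lam i)%N.
pose chi i := @char_map R n d w a lam s i.
have HX := @WGr_hausdorff R n d w a a0.
have imE i := char_map_image R w lam s d0 a0 i.
have cont i := @char_map_continuous R n d w a lam s i.
have sub k : @open_disc R k `<=` @closed_disc R k by move=> x; exact: ltW.
have disj : trivIset [set: 'I_('C(n, d))] (fun i => chi i @` @open_disc R _).
  move=> i j _ _ [x [xi xj]]; move: xi xj; rewrite /chi !imE =>
    -[A Ai Ax] [B Bj Bx].
  exact: (in_cell_uniq lamO Ai (in_cell_pi (etrans Bx (esym Ax)) Bj)).
have emb i : embedding_on (@open_disc R (dimf i)) (chi i).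
  apply: (@compact_embedding 'rV[R]_(dimf i) _ 0 (@closed_disc R _)
    (@open_disc R _) (chi i)
    HX (@closed_disc_compact R _) (sub _) (cont i)).
    by move=> x y; exact: (char_map_inj a0 lamO div_s).
  (* A boundary point lands in a cell of smaller dimension; if it also lay in cell [i], disjointness
     would identify the two. *)
  move=> x xd nxd xi; have [j jlt xj] := char_map_sphere w s d0 a0 lamO xd nxd.
  have ij : i = j by apply: disj => //; exists (chi i x).
  by rewrite ij ltnn in jlt.
have cov : \bigcup_(i in [set: 'I_('C(n, d))])
  (chi i @` @open_disc R _) = [set: WGr R d w a].
  apply/seteqP; split=> // x _; have [i xi] := in_cell_exists s lamO (repr x).
  by exists i => //; rewrite /chi imE; exists (repr x) => //; exact: reprK.
have bdry i : exists F : set 'I_('C(n, d)), [/\ finite_set F,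
    forall j, F j -> (dimf j < dimf i)%N
  & chi i @` @unit_sphere R _ `<=` \bigcup_(j in F) (chi j @` @open_disc R _)].
  (* All cells of smaller dimension are taken at once, the index type being finite. *)
  exists [set j | (dimf j < dimf i)%N]; split=> //.
  move=> _ [x xs <-]; have [||j jlt jx] :=
    @char_map_sphere R n d w a lam s d0 a0 lamO i x.
  - by rewrite /closed_disc /= xs.
  - by rewrite /open_disc /= xs ltxx.
  - by exists j => //=; rewrite /dimf -addSn leq_add // ltnW.
have weak (A : set (WGr R d w a)) :
    (forall i, closed (A `&` chi i @` @closed_disc R _)) -> closed A.
  (* The closed cells cover the space and are finite in number, so [A] is a finite union of closed
     sets. *)
  move=> cA; rewrite (_ : A = \bigcup_(i in [set: 'I_('C(n, d))])
    (A `&` chi i @` @closed_disc R _)).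
    by apply: closed_bigcup => [|i _]; [exact: finite_finset|exact: cA].
  apply/seteqP; split=> [x Ax|x [i _ []//]].
  have : [set: WGr R d w a] x by [].
  rewrite -cov => -[i _ [y yd yx]]; exists i => //; split=> //.
  by exists y => //; exact: sub.
exists (CWStructure R (WGr R d w a) 'I_('C(n, d)) dimf chi HX
  (fun i => continuous_subspaceT (cont i)) emb disj cov bdry weak).
split=> /= [i t|i]; last by rewrite /dimf addnn odd_double.
rewrite /open_cell /= /chi !imE => _ [_ [A Ai <-] <-].
rewrite torus_act_pi; exists (torus_mul t A); [exact: in_cell_torus | by []].
Qed.
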